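(* Let $n \geq 4$. The cone \[\hat{C} = \{R : R \text{ is an algebraic curvature operator on } \mathbb{R}^n \text{ and } \hat{R} \text{ has nonnegative isotropic curvature}\}\] has the following properties: (i) The cone $\hat{C}$ is invariant under the ODE $\frac{d}{dt} R = Q(R)$. (ii) Every algebraic curvature operator $R \in \hat{C}$ has nonnegative sectional curvature. (iii) If $R$ is a nonnegative curvature operator on $\mathbb{R}^n$, then $R$ lies in $\hat{C}$.
   Context: An algebraic curvature operator (tensor) on a Euclidean space is a four-linear form $R$ satisfying $R_{ijkl} = -R_{jikl} = -R_{ijlk} = R_{klij}$ and the first Bianchi identity; equivalently, a symmetric bilinear form on two-vectors, $R(e_i\wedge e_j,e_k\wedge e_l)=R_{ijkl}$, satisfying the Bianchi identity. The sign convention is that $R_{1212}$ is the sectional curvature of the plane spanned by orthonormal $e_1,e_2$. $R$ is a nonnegative curvature operator if this bilinear form on $\wedge^2\mathbb{R}^n$ is positive semi-definite. $R$ has nonnegative isotropic curvature if $R_{1313} + R_{1414} + R_{2323} + R_{2424} - 2 \, R_{1234} \geq 0$ for every orthonormal four-frame $\{e_1,e_2,e_3,e_4\}$, where $R_{ijkl}=R(e_i,e_j,e_k,e_l)$. Given an algebraic curvature operator $R$ on $\mathbb{R}^n$, the algebraic curvature operator $\hat{R}$ on $\mathbb{R}^n \times \mathbb{R}^2$ is defined by $\hat{R}(\hat{v}_1,\hat{v}_2,\hat{v}_3,\hat{v}_4) = R(v_1,v_2,v_3,v_4)$ for $\hat{v}_j = (v_j,x_j) \in \mathbb{R}^n \times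 \mathbb{R}^2$. The quadratic map $Q$ is \[Q(R)_{ijkl} = R_{ijpq} \, R_{klpq} + 2 \, R_{ipkq} \, R_{jplq} - 2 \, R_{iplq} \, R_{jpkq},\] with components in an orthonormal basis and summation over repeated indices $p,q$. A set $F$ is invariant under the ODE if every solution $R(t)$, $t \in [0,T)$, with $R(0) \in F$ satisfies $R(t) \in F$ for all $t \in [0,T)$. *)

(* Defs.v *)
From HB Require Import structures.
From mathcomp Require Import all_boot all_order all_algebra.
From mathcomp Require Import all_classical all_reals all_analysis.

Set Implicit Arguments.
Unset Strict Implicit.
Unset Printing Implicit Defensive.

Import Order.TTheory GRing.Theory Num.Theory.
Import numFieldNormedType.Exports.

Local Open Scope classical_set_scope.
Local Open Scope ring_scope.

Definition dot (R : realType) (n : nat) (u v : 'rV[R]_n) : R :=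
  \sum_(i < n) u 0 i * v 0 i.

Definition basis_vector (R : realType) (n : nat) (i : 'I_n) : 'rV[R]_n :=
  delta_mx 0 i.

Definition orthonormal (R : realType) (n : nat) (s : seq 'rV[R]_n) : Prop :=
  forall i j : nat, (i < size s)%N -> (j < size s)%N ->
    dot s`_i s`_j = (i == j)%:R.

Definition form4 (R : realType) (n : nat) : Type :=
  'rV[R]_n -> 'rV[R]_n -> 'rV[R]_n -> 'rV[R]_n -> R.

Definition four_linear (R : realType) (n : nat) (S : form4 R n) : Prop :=
  [/\ forall v w z, scalar (fun u => S u v w z),
      forall u w z, scalar (fun v => S u v w z),
      forall u v z, scalar (fun w => S u v w z)
    & forall u v w, scalar (fun z => S u v w z)].

Definition algebraic_curvature (R : realType) (n : nat) (S : form4 R n) : Prop :=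
  [/\ four_linear S,
      forall u v w z, S u v w z = - S v u w z,
      forall u v w z, S u v w z = - S u v z w,
      forall u v w z, S u v w z = S w z u v
    & forall u v w z, S u v w z + S v w u z + S w u v z = 0].

(* Sign convention: S u v u v is the sectional curvature of the plane spanned
   by the orthonormal vectors u and v. *)
Definition nonneg_sectional (R : realType) (n : nat) (S : form4 R n) : Prop :=
  forall u v, orthonormal [:: u; v] -> 0 <= S u v u v.

Definition nonneg_isotropic (R : realType) (n : nat) (S : form4 R n) : Prop :=
  forall e1 e2 e3 e4, orthonormal [:: e1; e2; e3; e4] ->
    0 <= S e1 e3 e1 e3 + S e1 e4 e1 e4 + S e2 e3 e2 e3 + S e2 e4 e2 e4
         - 2 * S e1 e2 e3 e4.

(* Two-vectors on R^n are represented by skew-symmetric matrices: phi stands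
   for the sum over i < j of phi i j times e_i /\ e_j, so that u /\ v is the
   matrix u^T v - v^T u. *)
Definition two_vector (R : realType) (n : nat) (phi : 'M[R]_n) : Prop :=
  phi^T = - phi.

Definition wedge (R : realType) (n : nat) (u v : 'rV[R]_n) : 'M[R]_n :=
  u^T *m v - v^T *m u.

(* The bilinear form on two-vectors whose value on the basis elements
   e_i /\ e_j and e_k /\ e_l (i < j, k < l) is S e_i e_j e_k e_l; see
   two_vector_form_wedge below. *)
Definition two_vector_form (R : realType) (n : nat) (S : form4 R n)
    (phi psi : 'M[R]_n) : R :=
  \sum_(i < n) \sum_(j < n | (i < j)%N) \sum_(k < n) \sum_(l < n | (k < l)%N)
    phi i j * psi k l *
    S (basis_vector R i) (basis_vector R j)
      (basis_vector R k) (basis_vector R l).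

Definition nonneg_curvature_operator (R : realType) (n : nat)
    (S : form4 R n) : Prop :=
  forall phi : 'M[R]_n, two_vector phi -> 0 <= two_vector_form S phi phi.

(* R^n x R^2 is identified with R^(n + 2); lsubmx is the projection onto the
   factor R^n. *)
Definition hat (R : realType) (n : nat) (S : form4 R n) : form4 R (n + 2) :=
  fun v1 v2 v3 v4 => S (lsubmx v1) (lsubmx v2) (lsubmx v3) (lsubmx v4).

(* The four-linear form with components Q(S)_ijkl, evaluated on arbitrary
   vectors; the repeated indices p, q run over the standard basis. *)
Definition Q (R : realType) (n : nat) (S : form4 R n) : form4 R n :=
  fun u v w z =>
    \sum_(p < n) \sum_(q < n)
      let a := basis_vector R p in let b := basis_vector R q in
      (S u v a b * S w z a b
       + 2 * (S u a w b * S v a z b)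
       - 2 * (S u a z b * S v a w b)).

(* The interval [0, tau), where tau = +oo is allowed. *)
Definition time_interval (R : realType) (tau : \bar R) : set R :=
  [set t | 0 <= t /\ (t%:E < tau)%E].

(* Derivative relative to D: two-sided at interior points of D, and one-sided
   at the endpoint 0 of [0, tau). *)
Definition is_derive_within (R : realType) (D : set R) (f : R -> R)
    (t l : R) : Prop :=
  (f s - f t) / (s - t) @[s --> within D t^'] --> l.

Definition ode_solution (R : realType) (n : nat) (tau : \bar R)
    (S : R -> form4 R n) : Prop :=
  forall t, time_interval tau t ->
    algebraic_curvature (S t) /\
    forall u v w z,
      is_derive_within (time_interval tau) (fun s => S s u v w z) t
        (Q (S t) u v w z).

Definition ode_invariant (R : realType) (n : nat) (F : set (form4 R n)) : Prop :=
  forall (tau : \bar R) (S : R -> form4 R n),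
    (0 < tau)%E -> ode_solution tau S -> F (S 0) ->
    forall t, time_interval tau t -> F (S t).

Definition Chat (R : realType) (n : nat) : set (form4 R n) :=
  [set S | algebraic_curvature S /\ nonneg_isotropic (hat S)].

Lemma skew_bilinear_wedge (R : realType) (n : nat)
    (f : 'rV[R]_n -> 'rV[R]_n -> R) (u v : 'rV[R]_n) :
  (forall y, scalar (fun x => f x y)) -> (forall x, scalar (f x)) ->
  (forall x y, f x y = - f y x) ->
  \sum_(i < n) \sum_(j < n | (i < j)%N)
    wedge u v i j * f (basis_vector R i) (basis_vector R j) = f u v.
Proof.
move=> fl fr fN.
have f0 x : f x x = 0.
  by have /eqP := fN x x; rewrite -addr_eq0 -mulr2n mulrn_eq0 => /eqP.
have fsuml (g : 'I_n -> R) (h : 'I_n -> 'rV[R]_n) y :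
    f (\sum_i g i *: h i) y = \sum_i g i * f (h i) y.
  elim/big_ind2: _ => [|x1 x2 y1 y2 <- <-|i _].
  - by have := fl y (-1) 0 0; rewrite scaleN1r oppr0 addr0 mulN1r addNr.
  - by have := fl y 1 x2 y2; rewrite scale1r mul1r.
  - have f0y : f 0 y = 0.
      by have := fl y (-1) 0 0; rewrite scaleN1r oppr0 addr0 mulN1r addNr.
    by have := fl y (g i) (h i) 0; rewrite f0y !addr0.
have fsumr (g : 'I_n -> R) (h : 'I_n -> 'rV[R]_n) y :
    f y (\sum_i g i *: h i) = \sum_i g i * f y (h i).
  by rewrite fN fsuml -sumrN; apply: eq_bigr => i _; rewrite -mulrN -fN.
set e := @basis_vector R n.
have -> : f u v = \sum_i \sum_j u 0 i * v 0 j * f (e i) (e j).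
  rewrite {1}(row_sum_delta u) fsuml; apply: eq_bigr => i _.
  rewrite {1}(row_sum_delta v) fsumr mulr_sumr.
  by apply: eq_bigr => j _; rewrite mulrA.
pose G i j := u 0 i * v 0 j * f (e i) (e j).
have wE i j : wedge u v i j * f (e i) (e j) = G i j + G j i.
  rewrite /wedge /G !mxE !big_ord1 !mxE (fN (e j)) mulrN -mulNr -mulrDl.
  by congr (_ * _); rewrite (mulrC (v 0 i)).
under eq_bigr do under eq_bigr do rewrite wE.
under eq_bigr do rewrite big_split.
rewrite big_split /= [X in _ + X](exchange_big_dep xpredT) //= -big_split /=.
apply: eq_bigr => i _; rewrite -/(G i) [RHS](bigID (fun j : 'I_n => (i < j)%N)) /=.
congr (_ + _); rewrite [RHS](bigD1 i) ?ltnn //= f0 mulr0 add0r.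
by apply: eq_bigl => j; rewrite -leqNgt ltn_neqAle andbC.
Qed.

Lemma two_vector_form_wedge (R : realType) (n : nat) (S : form4 R n)
    (u v w z : 'rV[R]_n) :
  algebraic_curvature S ->
  two_vector_form S (wedge u v) (wedge w z) = S u v w z.
Proof.
move=> [[l1 l2 l3 l4] N1 N2 _ _].
rewrite -(@skew_bilinear_wedge _ _ (fun x y => S x y w z) u v) //.
apply: eq_bigr => i _; apply: eq_bigr => j _.
rewrite -(@skew_bilinear_wedge _ _ (S (basis_vector R i) (basis_vector R j)) w z) //.
rewrite mulr_sumr; apply: eq_bigr => k _.
by rewrite mulr_sumr; apply: eq_bigr => l _; rewrite mulrA.
Qed.

(* Main.v *)
Require Import Defs.
From mathcomp Require Import all_boot all_order all_algebra.
From mathcomp Require Import all_classical all_reals all_analysis.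
From mathcomp Require Import ring lra.

Set Implicit Arguments.
Unset Strict Implicit.
Unset Printing Implicit Defensive.

Import Order.TTheory GRing.Theory Num.Theory.
Import numFieldNormedType.Exports.

Local Open Scope classical_set_scope.
Local Open Scope ring_scope.

(** A pair of complex vectors zeta = a + i b, eta = c + i d is given by the four
    real vectors a, b, c, d.  For a curvature tensor S, extended complex
    multilinearly, S(zeta, eta, conj zeta, conj eta) is the real number
    [plane_form S a b c d]; a complex change of basis with determinant delta
    multiplies it by |delta|^2, so its sign depends only on the complex plane
    spanned by zeta and eta.

    The cone consists of the S for which [plane_form S] is nonnegative on all
    pairs ([nonneg_isotropic_hat] and [isotropic_hat_plane_form]).  One
    direction is clear, because isotropic curvature is [plane_form] on an
    orthonormal four-frame.  For the other, the complex symmetric 2 x 2 matrix of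
    scalar products of zeta and eta is minus a matrix M M^T, and adding the rows
    of M as components in C^2 makes the plane totally isotropic in C^(n+2).  A
    unitary basis of an isotropic plane consists, up to a common factor, of
    e1 + i e2 and e3 + i e4 with e1, ..., e4 orthonormal, so the hypothesis on
    hat S applies to it.  Now (ii) is the case b = d = 0, and (iii) holds because
    [plane_form] is the Hermitian extension of the curvature operator evaluated
    at zeta /\ eta.

    For (i) the infinitesimal statement is [Q_plane_form_ge0]: if [plane_form S]
    is nonnegative everywhere and vanishes at (zeta, eta), then [plane_form (Q S)]
    is nonnegative at (zeta, eta).  The argument is Wilking's.  Averaging the
    second variation of [plane_form S] over the directions (xi, omega) and
    (i xi, i omega) leaves only its Hermitian part, which shows that S is
    nonnegative on the complex two-vectors xi /\ eta + zeta /\ omega ([second_variation]).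
    This is a positive semi-definite Hermitian form in (xi, omega); call its
    diagonal blocks A and C and its off-diagonal block B.  Expanding Q, the value
    of [plane_form (Q S)] is a sum of squares plus 2 (tr(A C^T) - tr(B conj B)),
    and the last bracket is half the trace of the product of the form with the
    form obtained from it by (xi, omega) |-> (conj omega, - conj xi), hence
    nonnegative ([hermitian_trace_ge0]).

    The passage to solutions is a barrier argument ([ode_nonneg_plane_form]).
    Let I be the curvature of the unit sphere, whose [plane_form] is 1 on unitary
    pairs, and add epsilon exp (L (t - T)) I to S(t).  Where the sum first touches
    the boundary of the cone, the infinitesimal statement holds for it, and Q
    is Lipschitz along the solution, so for L large the exponential grows faster
    than the error and contact is impossible.  Compactness of the set of unitary
    pairs ([frames_min]) turns strict positivity at one time into positivity for
    a short time.  Finally epsilon tends to 0. *)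

(** * Linear forms and curvature tensors *)

Section ScalarForms.
Context (R : realType) (V : lmodType R) (f : V -> R).
Hypothesis fl : scalar f.

Lemma lin_formD u v : f (u + v) = f u + f v.
Proof. by have := fl 1 u v; rewrite scale1r mul1r. Qed.

Lemma lin_form0 : f 0 = 0.
Proof. by apply: (addrI (f 0)); rewrite -lin_formD !addr0. Qed.

Lemma lin_formZ k u : f (k *: u) = k * f u.
Proof. by have := fl k u 0; rewrite lin_form0 !addr0. Qed.

Lemma lin_formN u : f (- u) = - f u.
Proof. by rewrite -scaleN1r lin_formZ mulN1r. Qed.

Lemma lin_formB u v : f (u - v) = f u - f v.
Proof. by rewrite lin_formD lin_formN. Qed.

End ScalarForms.

Section Curvature.
Context (R : realType) (n : nat) (S : form4 R n).
Hypothesis cS : algebraic_curvature S.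

Lemma curv_scalar1 v w z : scalar (fun u => S u v w z).
Proof. by case: cS => -[]. Qed.
Lemma curv_scalar2 u w z : scalar (fun v => S u v w z).
Proof. by case: cS => -[]. Qed.
Lemma curv_scalar3 u v z : scalar (fun w => S u v w z).
Proof. by case: cS => -[]. Qed.
Lemma curv_scalar4 u v w : scalar (fun z => S u v w z).
Proof. by case: cS => -[]. Qed.

Lemma curv_skew12 u v w z : S u v w z = - S v u w z.
Proof. by case: cS. Qed.
Lemma curv_skew34 u v w z : S u v w z = - S u v z w.
Proof. by case: cS. Qed.
Lemma curv_pair u v w z : S u v w z = S w z u v.
Proof. by case: cS. Qed.
Lemma curv_bianchi u v w z : S u v w z + S v w u z + S w u v z = 0.
Proof. by case: cS. Qed.

End Curvature.

Section TwoVectorForm.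
Context (R : realType) (n : nat) (S : form4 R n).

Lemma two_vector_form_scalarl psi : scalar (fun phi => two_vector_form S phi psi).
Proof.
move=> k x y; rewrite /two_vector_form mulr_sumr -big_split; apply: eq_bigr => i _.
rewrite mulr_sumr -big_split; apply: eq_bigr => j _.
rewrite mulr_sumr -big_split; apply: eq_bigr => p _.
rewrite mulr_sumr -big_split; apply: eq_bigr => q _ /=.
by rewrite !mxE; ring.
Qed.

Lemma two_vector_form_scalarr phi : scalar (two_vector_form S phi).
Proof.
move=> k x y; rewrite /two_vector_form mulr_sumr -big_split; apply: eq_bigr => i _.
rewrite mulr_sumr -big_split; apply: eq_bigr => j _.
rewrite mulr_sumr -big_split; apply: eq_bigr => p _.
rewrite mulr_sumr -big_split; apply: eq_bigr => q _ /=.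
by rewrite !mxE; ring.
Qed.

Lemma two_vector_formDD x y :
  two_vector_form S (x + y) (x + y) =
  two_vector_form S x x + two_vector_form S x y
  + (two_vector_form S y x + two_vector_form S y y).
Proof.
by rewrite (lin_formD (two_vector_form_scalarl _)) !(lin_formD (two_vector_form_scalarr _)).
Qed.

Lemma two_vector_formBB x y :
  two_vector_form S (x - y) (x - y) =
  two_vector_form S x x - two_vector_form S x y
  - (two_vector_form S y x - two_vector_form S y y).
Proof.
by rewrite (lin_formB (two_vector_form_scalarl _)) !(lin_formB (two_vector_form_scalarr _)).
Qed.

Lemma two_vector_formZZ k phi :
  two_vector_form S (k *: phi) (k *: phi) = k ^+ 2 * two_vector_form S phi phi.
Proof.
rewrite (lin_formZ (two_vector_form_scalarl _)) (lin_formZ (two_vector_form_scalarr _)).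
by rewrite mulrA.
Qed.

Lemma two_vector_form_parallelogram phi psi :
  two_vector_form S (phi + psi) (phi + psi) +
  two_vector_form S (phi - psi) (phi - psi) =
  2 * (two_vector_form S phi phi + two_vector_form S psi psi).
Proof.
rewrite two_vector_formDD two_vector_formBB; ring.
Qed.

End TwoVectorForm.

(** * The Hermitian form of a curvature tensor on decomposable two-vectors *)

(** S(a + i b, c + i d, a - i b, c - i d) for tensors with the symmetries of a
    curvature tensor.  This expression does not presuppose the Bianchi identity,
    so it is the right one for Q S as well. *)
Definition plane_form (R : realType) (n : nat) (S : form4 R n)
    (a b c d : 'rV[R]_n) : R :=
  S a c a c + S b d b d + S a d a d + S b c b c
  + 2 * (S a d b c - S a c b d).

(** [wedge_re] and [wedge_im] are the real and imaginary part of
    (a + i b) /\ (c + i d). *)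
Definition wedge_re (R : realType) (n : nat) (a b c d : 'rV[R]_n) : 'M[R]_n :=
  wedge a c - wedge b d.
Definition wedge_im (R : realType) (n : nat) (a b c d : 'rV[R]_n) : 'M[R]_n :=
  wedge a d + wedge b c.

Section PlaneForm.
Context (R : realType) (n : nat).
Implicit Types (S : form4 R n) (a b c d : 'rV[R]_n).

Lemma plane_form_two_vector S a b c d : algebraic_curvature S ->
  plane_form S a b c d =
  two_vector_form S (wedge_re a b c d) (wedge_re a b c d) +
  two_vector_form S (wedge_im a b c d) (wedge_im a b c d).
Proof.
move=> cS; rewrite /wedge_re /wedge_im.
rewrite (two_vector_formBB _ (wedge a c)) (two_vector_formDD _ (wedge a d)).
rewrite !two_vector_form_wedge // /plane_form.
rewrite (curv_pair cS b d a c) (curv_pair cS b c a d); ring.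
Qed.

(** The Bianchi identity collects the two mixed terms of [plane_form] into the
    one of isotropic curvature. *)
Lemma plane_form_isotropic S a b c d : algebraic_curvature S ->
  plane_form S a b c d = S a c a c + S a d a d + S b c b c + S b d b d
     - 2 * S a b c d.
Proof.
move=> cS; rewrite /plane_form.
have := curv_bianchi cS a c b d.
rewrite (curv_skew12 cS b a) (curv_pair cS c b) (curv_skew34 cS a d c b); lra.
Qed.

Lemma nonneg_curvature_plane_form S a b c d : algebraic_curvature S ->
  nonneg_curvature_operator S -> 0 <= plane_form S a b c d.
Proof.
move=> cS pS; rewrite plane_form_two_vector //.
by apply: addr_ge0; apply: pS; apply/matrixP => i j; rewrite !(mxE, big_ord1); ring.
Qed.

(** With l = l1 + i l2 the new pair is k zeta, m (eta + l zeta), and its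
    two-vector is k m (zeta /\ eta). *)
Lemma plane_form_shear S a b c d (k m l1 l2 : R) : algebraic_curvature S ->
  plane_form S (k *: a) (k *: b) (m *: (c + l1 *: a - l2 *: b))
    (m *: (d + l2 *: a + l1 *: b)) = (k * m) ^+ 2 * plane_form S a b c d.
Proof.
move=> cS; rewrite !plane_form_two_vector // mulrDr -!two_vector_formZZ.
set X := wedge_re _ _ (m *: _) _; set Y := wedge_im _ _ (m *: _) _.
have -> : X = (k * m) *: wedge_re a b c d.
  by apply/matrixP => i j; rewrite !(mxE, big_ord1); ring.
have -> // : Y = (k * m) *: wedge_im a b c d.
by apply/matrixP => i j; rewrite !(mxE, big_ord1); ring.
Qed.

(** * The second variation at a zero *)

(** Let X be the two-vector zeta /\ eta and let X + s Y + s^2 Z be that of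
    (zeta + s xi, eta + s omega).  For s replaced by s, -s, i s, -i s the
    Hermitian form of S is nonnegative, and the sum of the four values is
    4 (|X|^2 + s^2 |Y|^2 + s^4 |Z|^2), by the parallelogram identity.  The first
    term vanishes by hypothesis; dividing by s^2 and letting s tend to 0 leaves
    |Y|^2.  Here x1 + i x2 = xi and y1 + i y2 = omega. *)
Lemma second_variation S a b c d : algebraic_curvature S ->
  (forall a b c d, 0 <= plane_form S a b c d) -> plane_form S a b c d = 0 ->
  forall x1 x2 y1 y2,
  0 <= two_vector_form S (wedge_re x1 x2 c d + wedge_re a b y1 y2)
                         (wedge_re x1 x2 c d + wedge_re a b y1 y2)
     + two_vector_form S (wedge_im x1 x2 c d + wedge_im a b y1 y2)
                         (wedge_im x1 x2 c d + wedge_im a b y1 y2).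
Proof.
move=> cS pS zero x1 x2 y1 y2.
set Y1 := wedge_re x1 x2 c d + _; set Y2 := wedge_im x1 x2 c d + _.
pose q phi := two_vector_form S phi phi.
rewrite -/(q Y1) -/(q Y2).
set X1 := wedge_re a b c d; set X2 := wedge_im a b c d.
pose Z1 := wedge_re x1 x2 y1 y2; pose Z2 := wedge_im x1 x2 y1 y2.
have zero' : q X1 + q X2 = 0 by rewrite -zero plane_form_two_vector.
have E (s : R) : 0 < s -> 0 <= (q Y1 + q Y2) + s ^+ 2 * (q Z1 + q Z2).
  move=> s0.
  have := pS (a + s *: x1) (b + s *: x2) (c + s *: y1) (d + s *: y2).
  have := pS (a - s *: x1) (b - s *: x2) (c - s *: y1) (d - s *: y2).
  have := pS (a - s *: x2) (b + s *: x1) (c - s *: y2) (d + s *: y1).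
  have := pS (a + s *: x2) (b - s *: x1) (c + s *: y2) (d - s *: y1).
  rewrite !plane_form_two_vector //.
  have -> : wedge_re (a + s *: x1) (b + s *: x2) (c + s *: y1) (d + s *: y2) =
     (X1 + s ^+ 2 *: Z1) + s *: Y1.
    by apply/matrixP => i j; rewrite !(mxE, big_ord1); ring.
  have -> : wedge_re (a - s *: x1) (b - s *: x2) (c - s *: y1) (d - s *: y2) =
     (X1 + s ^+ 2 *: Z1) - s *: Y1.
    by apply/matrixP => i j; rewrite !(mxE, big_ord1); ring.
  have -> : wedge_im (a + s *: x1) (b + s *: x2) (c + s *: y1) (d + s *: y2) =
     (X2 + s ^+ 2 *: Z2) + s *: Y2.
    by apply/matrixP => i j; rewrite !(mxE, big_ord1); ring.
  have -> : wedge_im (a - s *: x1) (b - s *: x2) (c - s *: y1) (d - s *: y2) =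
     (X2 + s ^+ 2 *: Z2) - s *: Y2.
    by apply/matrixP => i j; rewrite !(mxE, big_ord1); ring.
  have -> : wedge_re (a - s *: x2) (b + s *: x1) (c - s *: y2) (d + s *: y1) =
     (X1 - s ^+ 2 *: Z1) - s *: Y2.
    by apply/matrixP => i j; rewrite !(mxE, big_ord1); ring.
  have -> : wedge_re (a + s *: x2) (b - s *: x1) (c + s *: y2) (d - s *: y1) =
     (X1 - s ^+ 2 *: Z1) + s *: Y2.
    by apply/matrixP => i j; rewrite !(mxE, big_ord1); ring.
  have -> : wedge_im (a - s *: x2) (b + s *: x1) (c - s *: y2) (d + s *: y1) =
     (X2 - s ^+ 2 *: Z2) + s *: Y1.
    by apply/matrixP => i j; rewrite !(mxE, big_ord1); ring.
  have -> : wedge_im (a + s *: x2) (b - s *: x1) (c + s *: y2) (d - s *: y1) =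
     (X2 - s ^+ 2 *: Z2) - s *: Y1.
    by apply/matrixP => i j; rewrite !(mxE, big_ord1); ring.
  have P1 := two_vector_form_parallelogram S (X1 + s ^+ 2 *: Z1) (s *: Y1).
  have P2 := two_vector_form_parallelogram S (X2 + s ^+ 2 *: Z2) (s *: Y2).
  have P3 := two_vector_form_parallelogram S (X1 - s ^+ 2 *: Z1) (s *: Y2).
  have P4 := two_vector_form_parallelogram S (X2 - s ^+ 2 *: Z2) (s *: Y1).
  have P5 := two_vector_form_parallelogram S X1 (s ^+ 2 *: Z1).
  have P6 := two_vector_form_parallelogram S X2 (s ^+ 2 *: Z2).
  rewrite !two_vector_formZZ in P1 P2 P3 P4 P5 P6 *.
  move=> H1 H2 H3 H4.
  rewrite -(@pmulr_rge0 _ (s ^+ 2)) ?exprn_gt0 //.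
  have -> : s ^+ 2 * (q Y1 + q Y2 + s ^+ 2 * (q Z1 + q Z2)) =
     s ^+ 2 * q Y1 + s ^+ 2 * q Y2 + ((s ^+ 2) ^+ 2 * q Z1 + (s ^+ 2) ^+ 2 * q Z2) by ring.
  move: zero' P1 P2 P3 P4 P5 P6 H1 H2 H3 H4; rewrite /q; clear.
  by repeat match goal with |- context [two_vector_form S ?x ?y] =>
    move: (two_vector_form S x y) => ? end; lra.
(* If the sum A of the Y terms were negative, s^2 = - A / (2 (|B| + 1)) would
   contradict E. *)
rewrite leNgt; apply/negP => neg.
set A := q Y1 + q Y2 in E neg; set B := q Z1 + q Z2 in E.
have B0 : 0 < `|B| + 1 by rewrite ltr_wpDl.
have t0 : 0 < - A / (`|B| + 1) / 2 by rewrite !divr_gt0 ?oppr_gt0.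
have := E (Num.sqrt (- A / (`|B| + 1) / 2)); rewrite sqrtr_gt0 => /(_ t0).
rewrite sqr_sqrtr; last exact: ltW.
have B1 : B / (`|B| + 1) <= 1.
  by rewrite ler_pdivrMr // mul1r (le_trans (ler_norm _)) // lerDl.
have : - A * (B / (`|B| + 1)) <= - A by rewrite ler_piMr // oppr_ge0 ltW.
have -> : - A / (`|B| + 1) / 2 * B = - A * (B / (`|B| + 1)) / 2 by ring.
lra.
Qed.

End PlaneForm.

(** * Traces of products of positive semi-definite matrices *)

Lemma mx11_tr (R : realType) (M : 'M[R]_1) : M^T = M.
Proof. by apply/matrixP => i j; rewrite mxE !ord1. Qed.

Definition mxform (R : realType) (m n : nat) (M : 'M[R]_(m, n)) (u : 'rV_m) (v : 'rV_n) : R :=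
  (u *m M *m v^T) 0 0.

Section MxForm.
Context (R : realType).

Lemma mxformDm m n (M N : 'M[R]_(m, n)) u v : mxform (M + N) u v = mxform M u v + mxform N u v.
Proof. by rewrite /mxform mulmxDr mulmxDl mxE. Qed.
Lemma mxformNm m n (M : 'M[R]_(m, n)) u v : mxform (- M) u v = - mxform M u v.
Proof. by rewrite /mxform mulmxN mulNmx mxE. Qed.
Lemma mxformNl m n (M : 'M[R]_(m, n)) u v : mxform M (- u) v = - mxform M u v.
Proof. by rewrite /mxform !mulNmx mxE. Qed.
Lemma mxformNr m n (M : 'M[R]_(m, n)) u v : mxform M u (- v) = - mxform M u v.
Proof. by rewrite /mxform linearN mulmxN mxE. Qed.
Lemma mxform_tr m n (M : 'M[R]_(m, n)) u v : mxform M^T u v = mxform M v u.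
Proof. by rewrite /mxform -(mx11_tr (v *m M *m u^T)) !trmx_mul !trmxK mulmxA. Qed.
Lemma mxform_block m1 m2 n1 n2 (M11 : 'M[R]_(m1, n1)) (M12 : 'M[R]_(m1, n2))
    (M21 : 'M[R]_(m2, n1)) (M22 : 'M[R]_(m2, n2)) u1 u2 v1 v2 :
  mxform (block_mx M11 M12 M21 M22) (row_mx u1 u2) (row_mx v1 v2) =
  mxform M11 u1 v1 + mxform M12 u1 v2 + mxform M21 u2 v1 + mxform M22 u2 v2.
Proof.
by rewrite /mxform mul_row_block tr_row_mx mul_row_col !mulmxDl !mxE; ring.
Qed.

End MxForm.

Definition psd (R : realType) (m : nat) (M : 'M[R]_m) : Prop :=
  forall v : 'rV_m, 0 <= mxform M v v.

(** Completing a positive semi-definite matrix to a square proceeds by splitting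
    off the first row and column; this is its quadratic form in that splitting. *)
Lemma mxform_bordered (R : realType) (m : nat) (a t : R) (u x : 'rV[R]_m) (D : 'M[R]_m) :
  let v : 'rV[R]_(1 + m) := row_mx t%:M x in
  mxform (block_mx a%:M u u^T D) v v =
  a * t ^+ 2 + 2 * t * (u *m x^T) 0 0 + mxform D x x.
Proof.
move=> v; rewrite /v /mxform mul_row_block tr_row_mx mul_row_col !mulmxDl.
rewrite !mul_scalar_mx tr_scalar_mx !mul_mx_scalar.
have -> : x *m u^T = u *m x^T by rewrite -[LHS]mx11_tr trmx_mul trmxK.
by rewrite -scalemxAl !mxE eqxx mulr1n; ring.
Qed.

Lemma bordered_gram (R : realType) (m : nat) (s : R) (w : 'rV[R]_m) (V : 'M[R]_m) :
  let W : 'M[R]_(1 + m) := block_mx s%:M w 0 V in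
  W^T *m W = block_mx (s * s)%:M (s *: w) (s *: w)^T (w^T *m w + V^T *m V).
Proof.
move=> W; rewrite /W tr_block_mx mulmx_block trmx0 !mulmx0 !mul0mx !addr0.
by rewrite tr_scalar_mx linearZ /= -scalar_mxM mul_scalar_mx mul_mx_scalar.
Qed.

(** Induction on the size.  A zero corner entry a forces the rest u of its row to
    vanish; otherwise the Schur complement D - a^-1 u^T u is again positive
    semi-definite, as the form of M minimized over the first coordinate. *)
Lemma psd_gram (R : realType) (m : nat) (M : 'M[R]_m) :
  M^T = M -> psd M -> exists V : 'M[R]_m, M = V^T *m V.
Proof.
elim: m M => [|m IH] M MT pM; first by exists 0; apply/matrixP => -[].
have [a [u [D [ME DT]]]] : exists (a : R) (u : 'rV[R]_m) (D : 'M[R]_m),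
    M = block_mx a%:M u u^T D :> 'M[R]_(1 + m) /\ D^T = D.
  exists (M 0 0), (ursubmx (M : 'M[R]_(1 + m))), (drsubmx (M : 'M[R]_(1 + m))).
  rewrite -{1}(@submxK _ 1 m 1 m M) trmx_ursub trmx_drsub MT; split=> //.
  congr block_mx; apply/matrixP => i j; rewrite !ord1 !mxE.
  by congr (M _ _); apply: val_inj.
have form (t : R) (x : 'rV[R]_m) :
    0 <= a * t ^+ 2 + 2 * t * (u *m x^T) 0 0 + mxform D x x.
  by rewrite -mxform_bordered -ME; apply: pM.
have a0 : 0 <= a.
  by have := form 1 0; rewrite /mxform !mul0mx trmx0 mulmx0 !mxE; lra.
have [az|an] := eqVneq a 0.
  have u0 : u = 0.
    apply/eqP; apply/negPn/negP => un.
    have uu : 0 < (u *m u^T) 0 0.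
      rewrite mxE lt_neqAle sumr_ge0 => [|i _]; last by rewrite mxE -expr2 sqr_ge0.
      rewrite andbT eq_sym; apply: contraNneq un => /eqP.
      rewrite psumr_eq0 => [/allP uz|i _]; last by rewrite mxE -expr2 sqr_ge0.
      apply/eqP/rowP => i; have := uz i (mem_index_enum _).
      by rewrite !mxE -expr2 sqrf_eq0 => /eqP.
    (* At (t, u) the form is 2 t k + D(u, u), affine in t; this t makes it -1. *)
    set k := (u *m u^T) 0 0 in uu.
    have := form (- (mxform D u u + 1) / (2 * k)) u.
    rewrite az mul0r add0r -/k.
    have -> : 2 * (- (mxform D u u + 1) / (2 * k)) * k =
        - (mxform D u u + 1) by field; rewrite lt0r_neq0.
    lra.
  have [V VE] : exists V : 'M[R]_m, D = V^T *m V.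
    apply: IH => // x; have := form 0 x; lra.
  exists (block_mx 0%:M 0 0 V : 'M[R]_(1 + m)).
  rewrite ME; apply: etrans (esym (bordered_gram 0 0 V)).
  by rewrite az u0 mul0r scale0r trmx0 mulmx0 add0r VE.
have ap : 0 < a by rewrite lt_neqAle eq_sym an.
have [V VE] : exists V : 'M[R]_m, D - a^-1 *: (u^T *m u) = V^T *m V.
  apply: IH => [|x]; first by rewrite linearB linearZ /= trmx_mul trmxK DT.
  (* The first coordinate at which the form is minimal for given x. *)
  have := form (- (a^-1 * (u *m x^T) 0 0)) x.
  rewrite /mxform mulmxBr mulmxBl -scalemxAr -scalemxAl.
  have -> : x *m (u^T *m u) *m x^T = (u *m x^T) *m (u *m x^T).
    rewrite mulmxA -mulmxA; congr (_ *m _).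
    by rewrite -[LHS]mx11_tr trmx_mul trmxK.
  set k := (u *m x^T) 0 0; rewrite [X in _ -> 0 <= X]mxE.
  rewrite [X in _ -> 0 <= _ + X]mxE [X in _ -> 0 <= _ - X]mxE [X in _ -> 0 <= _ - _ * X]mxE.
  rewrite big_ord1 -/k => H; rewrite (le_trans H) // le_eqVlt; apply/orP; left; apply/eqP.
  by field.
pose s := Num.sqrt a.
have s2 : s * s = a by rewrite -expr2 sqr_sqrtr.
have sn : s != 0 by rewrite gt_eqF // sqrtr_gt0.
exists (block_mx s%:M (s^-1 *: u) 0 V : 'M[R]_(1 + m)).
rewrite ME; apply: etrans (esym (bordered_gram s (s^-1 *: u) V)).
have -> : (s^-1 *: u)^T *m (s^-1 *: u) = a^-1 *: (u^T *m u).
  by rewrite [(_ *: u)^T]linearZ /= -scalemxAl -scalemxAr scalerA -invfM s2.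
by rewrite !scalerA mulfV // !scale1r s2 -VE addrC subrK.
Qed.

(** With M = V^T V the trace is the sum of the values of N on the rows of V. *)
Lemma psd_trace_mul (R : realType) (m : nat) (M N : 'M[R]_m) :
  M^T = M -> psd M -> psd N -> 0 <= \tr (M *m N).
Proof.
move=> MT /(psd_gram MT) [V ->] pN.
rewrite -mulmxA mxtrace_mulC; apply: sumr_ge0 => i _.
have := pN (row i V); congr (_ <= _).
by rewrite /mxform -row_mul !mxE; apply: eq_bigr => j _; rewrite !mxE.
Qed.

(** The hypothesis says that the Hermitian matrix with diagonal blocks A1 + i A2
    and C1 + i C2 and off-diagonal block -(B1 + i B2), up to conjugations, is
    positive semi-definite; it is written as a real form of four times the block
    size.  The matrix N represents the same form after the substitution
    (x1, x2, y1, y2) |-> (y1, - y2, - x1, x2), and the trace of M N is four times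
    the quantity of the conclusion. *)
Lemma hermitian_trace_ge0 (R : realType) (n : nat) (A1 A2 C1 C2 B1 B2 : 'M[R]_n) :
  A1^T = A1 -> A2^T = - A2 -> C1^T = C1 -> C2^T = - C2 ->
  (forall x1 x2 y1 y2, 0 <= mxform A1 x1 x1 + mxform A1 x2 x2 - 2 * mxform A2 x1 x2
     + mxform C1 y1 y1 + mxform C1 y2 y2 - 2 * mxform C2 y1 y2
     - 2 * (mxform B1 x1 y1 + mxform B1 x2 y2 + mxform B2 x1 y2 - mxform B2 x2 y1)) ->
  0 <= \tr (A1 *m C1) + \tr (A2 *m C2) - \tr (B1 *m B1) - \tr (B2 *m B2).
Proof.
move=> A1T A2T C1T C2T pos.
pose M : 'M[R]_((n + n) + (n + n)) := block_mx
  (block_mx A1 (- A2) A2 A1) (block_mx (- B1) (- B2) B2 (- B1))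
  (block_mx (- B1^T) B2^T (- B2^T) (- B1^T)) (block_mx C1 (- C2) C2 C1).
pose N : 'M[R]_((n + n) + (n + n)) := block_mx
  (block_mx C1 C2 (- C2) C1) (block_mx B1^T B2^T (- B2^T) B1^T)
  (block_mx B1 (- B2) B2 B1) (block_mx A1 A2 (- A2) A1).
have A2s u v : mxform A2 u v = - mxform A2 v u by rewrite -mxform_tr A2T mxformNm.
have C2s u v : mxform C2 u v = - mxform C2 v u by rewrite -mxform_tr C2T mxformNm.
have MT : M^T = M.
  by rewrite /M !tr_block_mx !(linearN trmx) /= !trmxK A1T A2T C1T C2T !opprK.
have pM : psd M.
  move=> v; rewrite -(hsubmxK v).
  rewrite -(hsubmxK (lsubmx v)) -(hsubmxK (rsubmx v)).
  move: (lsubmx (lsubmx v)) (rsubmx (lsubmx v)) => x1 x2.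
  move: (lsubmx (rsubmx v)) (rsubmx (rsubmx v)) => y1 y2.
  rewrite !mxform_block !mxformNm !mxform_tr (A2s x2) (C2s y2).
  have := pos x1 x2 y1 y2; lra.
have pN : psd N.
  move=> v; rewrite -(hsubmxK v).
  rewrite -(hsubmxK (lsubmx v)) -(hsubmxK (rsubmx v)).
  move: (lsubmx (lsubmx v)) (rsubmx (lsubmx v)) => x1 x2.
  move: (lsubmx (rsubmx v)) (rsubmx (rsubmx v)) => y1 y2.
  rewrite !mxform_block !mxformNm !mxform_tr (A2s y2) (C2s x2).
  have := pos y1 (- y2) (- x1) x2; rewrite !(mxformNl, mxformNr) !opprK; lra.
have := psd_trace_mul MT pM pN.
rewrite /M /N mulmx_block mxtrace_block !mulmx_block !(raddfD mxtrace) /= !mxtrace_block.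
rewrite !(mulNmx, mulmxN, raddfD, raddfN) /= !opprK.
have trB (X Y : 'M[R]_n) : \tr (X^T *m Y^T) = \tr (X *m Y).
  by rewrite -trmx_mul mxtrace_tr mxtrace_mulC.
rewrite !trB (mxtrace_mulC C1) (mxtrace_mulC C2); lra.
Qed.

(** * The quadratic map points into the cone along its boundary *)

Section Tangency.
Context (R : realType) (n : nat) (S : form4 R n).
Hypothesis cS : algebraic_curvature S.

(** Both the second variation and Q are expressed through these matrices: they
    are the blocks of the former, and the non-square terms of the latter are
    traces of their products. *)
Definition curv_mx (x y : 'rV[R]_n) : 'M[R]_n :=
  \matrix_(p, q) S x (basis_vector R p) y (basis_vector R q).

Lemma scalar_coord (f : 'rV[R]_n -> R) u : scalar f ->
  f u = \sum_i u 0 i * f (basis_vector R i).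
Proof.
move=> fl; rewrite {1}(row_sum_delta u).
elim/big_ind2: _ => [|x1 x2 y1 y2 <- <-|i _].
- exact: lin_form0 fl.
- exact: lin_formD fl _ _.
- by rewrite (lin_formZ fl).
Qed.

Lemma curv_mx_form x y u v : mxform (curv_mx x y) u v = S x u y v.
Proof.
rewrite (scalar_coord u (curv_scalar2 cS x y v)) /mxform -mulmxA mxE.
apply: eq_bigr => i _; congr (_ * _).
rewrite (scalar_coord v (curv_scalar4 cS _ _ _)) mxE.
by apply: eq_bigr => j _; rewrite !mxE mulrC.
Qed.

Lemma tr_curv_mx x y : (curv_mx x y)^T = curv_mx y x.
Proof. by apply/matrixP => p q; rewrite !mxE (curv_pair cS). Qed.

Lemma Q_trace u v w z :
  Q S u v w z =
  \sum_p \sum_q S u v (basis_vector R p) (basis_vector R q)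
              * S w z (basis_vector R p) (basis_vector R q)
  + 2 * \tr (curv_mx u w *m curv_mx z v) - 2 * \tr (curv_mx u z *m curv_mx w v).
Proof.
have trE x y x' y' : \tr (curv_mx x y *m curv_mx x' y') =
    \sum_p \sum_q S x (basis_vector R p) y (basis_vector R q) *
                  S y' (basis_vector R p) x' (basis_vector R q).
  apply: eq_bigr => p _; rewrite mxE; apply: eq_bigr => q _.
  by rewrite !mxE (curv_pair cS x').
rewrite !trE !mulr_sumr -big_split -sumrB; apply: eq_bigr => p _ /=.
rewrite !mulr_sumr -big_split -sumrB; apply: eq_bigr => q _ /=.
by rewrite /=; ring.
Qed.

Lemma curv_mx_trace_sym x y z w :
  \tr (curv_mx x y *m curv_mx z w) = \tr (curv_mx w z *m curv_mx y x).
Proof. by rewrite -mxtrace_tr trmx_mul !tr_curv_mx. Qed.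

(** The terms S(u, v, p, q) S(w, z, p, q) of Q add up to the squares of the real
    and imaginary parts of S(zeta, eta, p, q); the traces add up to twice the
    quantity that [hermitian_trace_ge0] bounds for the second variation. *)
Lemma Q_plane_form_ge0 a b c d :
  (forall a b c d, 0 <= plane_form S a b c d) -> plane_form S a b c d = 0 ->
  0 <= plane_form (Q S) a b c d.
Proof.
move=> pS zero.
pose A1 := curv_mx c c + curv_mx d d; pose A2 := curv_mx c d - curv_mx d c.
pose C1 := curv_mx a a + curv_mx b b; pose C2 := curv_mx a b - curv_mx b a.
pose B1 := curv_mx c a + curv_mx d b; pose B2 := curv_mx d a - curv_mx c b.
have T : 0 <= \tr (A1 *m C1) + \tr (A2 *m C2) - \tr (B1 *m B1) - \tr (B2 *m B2).
  apply: hermitian_trace_ge0 => [||||x1 x2 y1 y2].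
  - by rewrite linearD /= !tr_curv_mx.
  - by rewrite linearB /= !tr_curv_mx opprB.
  - by rewrite linearD /= !tr_curv_mx.
  - by rewrite linearB /= !tr_curv_mx opprB.
  have := second_variation cS pS zero x1 x2 y1 y2.
  pose F := two_vector_form S.
  have -> (x y z t : 'M[R]_n) :
    two_vector_form S (x - y + (z - t)) (x - y + (z - t)) =
    F x x - F x y + F x z - F x t
    - (F y x - F y y + F y z - F y t)
    + (F z x - F z y + F z z - F z t)
    - (F t x - F t y + F t z - F t t).
    by rewrite /F !(lin_formD (two_vector_form_scalarl _ _),
      lin_formN (two_vector_form_scalarl _ _), lin_formD (two_vector_form_scalarr _ _),
      lin_formN (two_vector_form_scalarr _ _)); ring.
  have -> (x y z t : 'M[R]_n) :
    two_vector_form S (x + y + (z + t)) (x + y + (z + t)) =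
    F x x + F x y + F x z + F x t
    + (F y x + F y y + F y z + F y t)
    + (F z x + F z y + F z z + F z t)
    + (F t x + F t y + F t z + F t t).
    by rewrite /F !(lin_formD (two_vector_form_scalarl _ _),
      lin_formN (two_vector_form_scalarl _ _), lin_formD (two_vector_form_scalarr _ _),
      lin_formN (two_vector_form_scalarr _ _)); ring.
  rewrite /F !two_vector_form_wedge //.
  rewrite !(mxformDm, mxformNm) !curv_mx_form.
  have sw u v w z : S u v w z = S v u z w.
    by rewrite (curv_skew12 cS) (curv_skew34 cS) opprK.
  rewrite !(sw c x1, sw d x1, sw c x2, sw d x2).
  rewrite !(curv_skew34 cS _ _ y1, curv_skew34 cS _ _ y2).
  rewrite (curv_pair cS x2 d x1 c) (curv_pair cS x2 c x1 d).
  rewrite !(fun u v => curv_pair cS a u x1 v, fun u v => curv_pair cS a u x2 v).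
  rewrite !(fun u v => curv_pair cS b u x1 v, fun u v => curv_pair cS b u x2 v).
  rewrite (curv_pair cS b y2 a y1) (curv_pair cS a y2 b y1).
  lra.
have sq : 0 <= \sum_p \sum_q
   ((S a c (basis_vector R p) (basis_vector R q)
     - S b d (basis_vector R p) (basis_vector R q)) ^+ 2
   + (S a d (basis_vector R p) (basis_vector R q)
     + S b c (basis_vector R p) (basis_vector R q)) ^+ 2).
  by do 2![apply: sumr_ge0 => ? _]; rewrite addr_ge0 ?sqr_ge0.
rewrite /plane_form !Q_trace.
set s1 := \sum_p _; set s2 := \sum_p _; set s3 := \sum_p _; set s4 := \sum_p _.
set s5 := \sum_p _; set s6 := \sum_p _.
have sE : \sum_p \sum_q
   ((S a c (basis_vector R p) (basis_vector R q)
     - S b d (basis_vector R p) (basis_vector R q)) ^+ 2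
   + (S a d (basis_vector R p) (basis_vector R q)
     + S b c (basis_vector R p) (basis_vector R q)) ^+ 2) =
   s1 + s2 + s3 + s4 + 2 * (s5 - s6).
  rewrite /s1 /s2 /s3 /s4 /s5 /s6 -sumrB mulr_sumr -!big_split.
  apply: eq_bigr => p _ /=; rewrite -sumrB mulr_sumr -!big_split.
  by apply: eq_bigr => q _ /=; ring.
rewrite sE in sq.
move: T; rewrite /A1 /A2 /B1 /B2 /C1 /C2.
rewrite !(mulmxDl, mulmxDr, mulNmx, mulmxN) !(raddfD mxtrace, raddfN mxtrace) /=.
have sym := curv_mx_trace_sym; have com x y z w := mxtrace_mulC (curv_mx x y) (curv_mx z w).
rewrite (com c c a a) (com c c b b) (com d d a a) (com d d b b) (com c d a b) (com d c a b).
rewrite (sym c d b a) (sym d c b a) (sym c a c a) (sym d b d b) (sym d a d a) (sym c b c b).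
rewrite (sym c a d b) (com b d a c) (sym d b c a) (sym d a c b) (com b c a d) (sym c b d a).
lra.
Qed.

End Tangency.

(** * Unitary pairs *)

Section Dot.
Context (R : realType) (n : nat).
Implicit Types (u v w : 'rV[R]_n).

Lemma dotC u v : dot u v = dot v u.
Proof. by apply: eq_bigr => i _; rewrite mulrC. Qed.
Lemma dot_scalar u : scalar (dot u).
Proof.
move=> k x y; rewrite /dot mulr_sumr -big_split; apply: eq_bigr => i _ /=.
by rewrite !mxE; ring.
Qed.
Lemma dotDr u v w : dot u (v + w) = dot u v + dot u w.
Proof. exact: (lin_formD (dot_scalar u)). Qed.
Lemma dotNr u v : dot u (- v) = - dot u v.
Proof. exact: (lin_formN (dot_scalar u)). Qed.
Lemma dotZr k u v : dot u (k *: v) = k * dot u v.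
Proof. by rewrite (lin_formZ (dot_scalar u)). Qed.
Lemma dotDl u v w : dot (v + w) u = dot v u + dot w u.
Proof. by rewrite dotC dotDr !(dotC u). Qed.
Lemma dotNl u v : dot (- v) u = - dot v u.
Proof. by rewrite dotC dotNr (dotC u). Qed.
Lemma dotZl k u v : dot (k *: v) u = k * dot v u.
Proof. by rewrite dotC dotZr (dotC u). Qed.
Definition dotE := (dotDl, dotDr, dotNl, dotNr, dotZl, dotZr).

Lemma dot_ge0 u : 0 <= dot u u.
Proof. by apply: sumr_ge0 => i _; rewrite -expr2 sqr_ge0. Qed.
Lemma dot_eq0 u : dot u u = 0 -> u = 0.
Proof.
move=> /eqP; rewrite psumr_eq0 => [/allP uz|i _]; last by rewrite -expr2 sqr_ge0.
apply/rowP => i; have := uz i (mem_index_enum _).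
by rewrite !mxE -expr2 sqrf_eq0 => /eqP.
Qed.
Lemma dot_sum_eq0 u v : dot u u + dot v v = 0 -> u = 0 /\ v = 0.
Proof.
have := dot_ge0 u; have := dot_ge0 v => v0 u0 uv.
by split; apply: dot_eq0; lra.
Qed.

Lemma orthonormal4 (e1 e2 e3 e4 : 'rV[R]_n) :
  dot e1 e1 = 1 -> dot e2 e2 = 1 -> dot e3 e3 = 1 -> dot e4 e4 = 1 ->
  dot e1 e2 = 0 -> dot e1 e3 = 0 -> dot e1 e4 = 0 ->
  dot e2 e3 = 0 -> dot e2 e4 = 0 -> dot e3 e4 = 0 ->
  Defs.orthonormal [:: e1; e2; e3; e4].
Proof.
move=> ? ? ? ? ? ? ? ? ? ?.
by case=> [|[|[|[|i]]]] [|[|[|[|j]]]] //= _ _; rewrite // dotC.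
Qed.
End Dot.

Lemma dot_row_mx (R : realType) (m n : nat) (u1 v1 : 'rV[R]_m) (u2 v2 : 'rV[R]_n) :
  dot (row_mx u1 u2) (row_mx v1 v2) = dot u1 v1 + dot u2 v2.
Proof.
rewrite /dot big_split_ord /=.
by congr (_ + _); apply: eq_bigr => i _; rewrite ?row_mxEl ?row_mxEr.
Qed.

(** a + i b and c + i d are orthonormal for the Hermitian product of C^n; the last
    two equations are its real and imaginary part. *)
Definition hermitian_orthonormal (R : realType) (n : nat) (a b c d : 'rV[R]_n) : Prop :=
  [/\ dot a a + dot b b = 1, dot c c + dot d d = 1,
      dot a c + dot b d = 0 & dot a d - dot b c = 0].

Lemma plane_form0l (R : realType) n (S : form4 R n) c d :
  algebraic_curvature S -> plane_form S 0 0 c d = 0.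
Proof.
move=> cS; rewrite /plane_form.
by rewrite !(lin_form0 (curv_scalar1 cS _ _ _)) !(addr0, subr0, mulr0).
Qed.

Lemma plane_form0r (R : realType) n (S : form4 R n) a b :
  algebraic_curvature S -> plane_form S a b 0 0 = 0.
Proof.
move=> cS; rewrite /plane_form.
by rewrite !(lin_form0 (curv_scalar2 cS _ _ _)) !(addr0, subr0, mulr0).
Qed.

(** Gram-Schmidt over C, with l = l1 + i l2 the coefficient that makes
    eta + l zeta orthogonal to zeta; in the first case the two vectors are
    linearly dependent. *)
Lemma hermitian_reduction (R : realType) (n : nat) (a b c d : 'rV[R]_n) :
  (forall S : form4 R n, algebraic_curvature S -> plane_form S a b c d = 0) \/
  exists k m l1 l2 : R, [/\ 0 < k, 0 < m &
    hermitian_orthonormal (k *: a) (k *: b) (m *: (c + l1 *: a - l2 *: b))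
      (m *: (d + l2 *: a + l1 *: b))].
Proof.
set N := dot a a + dot b b.
have N0 : 0 <= N by rewrite addr_ge0 ?dot_ge0.
have [/dot_sum_eq0 [-> ->]|Nn] := eqVneq N 0.
  by left => S cS; exact: plane_form0l.
have Np : 0 < N by rewrite lt_neqAle eq_sym Nn.
pose l1 := - (dot a c + dot b d) / N; pose l2 := - (dot a d - dot b c) / N.
set c' := c + l1 *: a - l2 *: b; set d' := d + l2 *: a + l1 *: b.
set N' := dot c' c' + dot d' d'.
have N'0 : 0 <= N' by rewrite addr_ge0 ?dot_ge0.
have [/dot_sum_eq0 [cz dz]|N'n] := eqVneq N' 0.
  left => S cS; have := plane_form_shear a b c d 1 1 l1 l2 cS.
  by rewrite -/c' -/d' cz dz !scale1r mulr1 expr1n mul1r => <-; exact: plane_form0r.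
have N'p : 0 < N' by rewrite lt_neqAle eq_sym N'n.
have sqN (x : R) : 0 < x -> (Num.sqrt x)^-1 * (Num.sqrt x)^-1 * x = 1.
  move=> x0; rewrite -invfM -expr2 sqr_sqrtr ?ltW // mulVf // gt_eqF //.
right; exists (Num.sqrt N)^-1, (Num.sqrt N')^-1, l1, l2.
rewrite -/c' -/d'; split; rewrite ?invr_gt0 ?sqrtr_gt0 //.
have E1 : dot a c' + dot b d' = 0.
  rewrite /c' /d' !dotE (dotC b a).
  have -> : dot a c + l1 * dot a a - l2 * dot a b + (dot b d + l2 * dot a b + l1 * dot b b)
    = dot a c + dot b d + l1 * N by rewrite /N; ring.
  by rewrite /l1; field.
have E2 : dot a d' - dot b c' = 0.
  rewrite /c' /d' !dotE (dotC b a).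
  have -> : dot a d + l2 * dot a a + l1 * dot a b - (dot b c + l1 * dot a b - l2 * dot b b)
    = dot a d - dot b c + l2 * N by rewrite /N; ring.
  by rewrite /l2; field.
clearbody c' d'; split; rewrite !dotE.
- by rewrite !mulrA -mulrDr sqN.
- by rewrite !mulrA -mulrDr sqN.
- by rewrite !mulrA -mulrDr E1 mulr0.
- by rewrite !mulrA -mulrBr E2 mulr0.
Qed.

(** * The cone as a condition on all complex planes *)

(** The parts of a square root of p + i q have squares (r + p) / 2 and (r - p) / 2
    with r = |p + i q|; the sign of y is that of q. *)
Lemma complex_square_root (R : realType) (p q : R) :
  exists x y : R, x ^+ 2 - y ^+ 2 = p /\ 2 * (x * y) = q.
Proof.
pose r := Num.sqrt (p ^+ 2 + q ^+ 2).
have r2 : r ^+ 2 = p ^+ 2 + q ^+ 2 by rewrite sqr_sqrtr // addr_ge0 ?sqr_ge0.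
have : `|p| <= r.
  by rewrite -(@ler_pXn2r _ 2) ?nnegrE ?sqrtr_ge0 // real_normK ?num_real // r2 lerDl sqr_ge0.
rewrite ler_norml => /andP[rp pr].
pose x := Num.sqrt ((r + p) / 2); pose y := Num.sqrt ((r - p) / 2).
have x2 : x ^+ 2 = (r + p) / 2 by rewrite sqr_sqrtr // divr_ge0 //; lra.
have y2 : y ^+ 2 = (r - p) / 2 by rewrite sqr_sqrtr // divr_ge0 //; lra.
have xy : 2 * (x * y) = `|q|.
  apply/eqP; rewrite -(@eqrXn2 _ 2) // ?mulr_ge0 ?sqrtr_ge0 // real_normK ?num_real //.
  by rewrite !exprMn x2 y2; apply/eqP; have := r2; lra.
have [q0|q0] := leP 0 q.
  by exists x, y; rewrite x2 y2 xy ger0_norm //; split=> //; lra.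
exists x, (- y); rewrite sqrrN x2 y2 !mulrN xy ltr0_norm // opprK; split=> //; lra.
Qed.

(** A complex symmetric 2 x 2 matrix ((p, q), (q, r)) is of the form M M^T; the
    rows of M are x1 + i x2 and y1 + i y2.  If p or r is nonzero, M can be taken
    triangular, with a square root of p or r in the corner; the matrix with
    p = r = 0 is handled by the isotropic vectors (1, i) and q / 2 (1, -i). *)
Lemma isotropic_extension (R : realType) (p1 p2 q1 q2 r1 r2 : R) :
  exists x1 x2 y1 y2 : 'rV[R]_2,
    [/\ dot x1 x1 - dot x2 x2 = p1 /\ 2 * dot x1 x2 = p2,
        dot x1 y1 - dot x2 y2 = q1 /\ dot x1 y2 + dot x2 y1 = q2 &
        dot y1 y1 - dot y2 y2 = r1 /\ 2 * dot y1 y2 = r2].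
Proof.
pose v (s t : R) : 'rV[R]_2 := row_mx (s%:M : 'rV_1) (t%:M : 'rV_1).
have dotv s t s' t' : dot (v s t) (v s' t') = s * s' + t * t'.
  by rewrite (@dot_row_mx R 1 1) /dot !big_ord1 !mxE !eqxx !mulr1n.
have gen (p1' p2' q1' q2' r1' r2' : R) : (p1', p2') != (0, 0) ->
  exists x1 x2 y1 y2 : 'rV[R]_2,
    [/\ dot x1 x1 - dot x2 x2 = p1' /\ 2 * dot x1 x2 = p2',
        dot x1 y1 - dot x2 y2 = q1' /\ dot x1 y2 + dot x2 y1 = q2' &
        dot y1 y1 - dot y2 y2 = r1' /\ 2 * dot y1 y2 = r2'].
  move=> pn; have [s1 [s2 [sp1 sp2]]] := complex_square_root p1' p2'.
  pose m := s1 ^+ 2 + s2 ^+ 2.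
  have mn : m != 0.
    apply: contraNneq pn => m0.
    have /andP[/eqP s10 /eqP s20] : (s1 == 0) && (s2 == 0).
      by rewrite -(sqrf_eq0 s1) -(sqrf_eq0 s2) -paddr_eq0 ?sqr_ge0 // -/m m0.
    by rewrite -sp1 -sp2 s10 s20 mul0r mulr0 subrr.
  (* u1 + i u2 = q / (s1 + i s2) *)
  pose u1 := (q1' * s1 + q2' * s2) / m; pose u2 := (q2' * s1 - q1' * s2) / m.
  have [t1 [t2 [tr1 tr2]]] :=
    complex_square_root (r1' - (u1 ^+ 2 - u2 ^+ 2)) (r2' - 2 * (u1 * u2)).
  exists (v s1 0), (v s2 0), (v u1 t1), (v u2 t2); rewrite !dotv.
  split; split.
  - by rewrite -sp1; ring.
  - by rewrite -sp2; ring.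
  - by rewrite /u1 /u2 /m; field.
  - by rewrite /u1 /u2 /m; field.
  - by have := tr1; lra.
  - by have := tr2; lra.
have [[p10 p20]|] := eqVneq (p1, p2) (0, 0); last exact: gen.
have [[r10 r20]|] := eqVneq (r1, r2) (0, 0); last first.
  move=> /(gen r1 r2 q1 q2 p1 p2) [x1 [x2 [y1 [y2 [h1 [h2 h3] h4]]]]].
  exists y1, y2, x1, x2; split=> //; split.
    by rewrite -h2 (dotC y1) (dotC y2).
  by rewrite -h3 (dotC y1) (dotC y2) addrC.
exists (v 1 0), (v 0 1), (v (q1 / 2) (q2 / 2)), (v (q2 / 2) (- (q1 / 2))).
rewrite !dotv p10 p20 r10 r20; split; split; by field.
Qed.

Section Chat.
Context (R : realType) (n : nat) (S : form4 R n).
Hypothesis cS : algebraic_curvature S.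

Lemma hat_curvature : algebraic_curvature (hat S).
Proof.
split; first by split=> x y z k u v; rewrite /hat linearP /=;
  [apply: (curv_scalar1 cS)|apply: (curv_scalar2 cS)
  |apply: (curv_scalar3 cS)|apply: (curv_scalar4 cS)].
- by move=> *; exact: (curv_skew12 cS).
- by move=> *; exact: (curv_skew34 cS).
- by move=> *; exact: (curv_pair cS).
- by move=> *; exact: (curv_bianchi cS).
Qed.

Lemma plane_form_hat a b c d :
  plane_form (hat S) a b c d =
  plane_form S (lsubmx a) (lsubmx b) (lsubmx c) (lsubmx d).
Proof. by []. Qed.

Lemma nonneg_isotropic_hat : (forall a b c d, 0 <= plane_form S a b c d) ->
  nonneg_isotropic (hat S).
Proof.
move=> pS e1 e2 e3 e4 _.
have := pS (lsubmx e1) (lsubmx e2) (lsubmx e3) (lsubmx e4).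
rewrite plane_form_isotropic // /hat; lra.
Qed.

(** The pair is extended to an isotropic plane of C^(n+2), whose unitary basis
    A' + i B', C' + i D' has real and imaginary parts that are orthogonal and of
    squared length 1/2. *)
Lemma isotropic_hat_plane_form a b c d :
  nonneg_isotropic (hat S) -> 0 <= plane_form S a b c d.
Proof.
move=> isoS.
have [x1 [x2 [y1 [y2 [[p1 p2] [q1 q2] [r1 r2]]]]]] := isotropic_extension
  (dot b b - dot a a) (- 2 * dot a b) (dot b d - dot a c) (- dot a d - dot b c)
  (dot d d - dot c c) (- 2 * dot c d).
set A := row_mx a x1; set B := row_mx b x2; set C := row_mx c y1; set D := row_mx d y2.
have -> : plane_form S a b c d = plane_form (hat S) A B C D.
  by rewrite plane_form_hat !row_mxKl.
have cH := hat_curvature.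
have [z|] := hermitian_reduction A B C D; first by rewrite z.
move=> [k [m [l1 [l2 [k0 m0]]]]].
have BB : dot B B = dot A A by rewrite !dot_row_mx; lra.
have AB : dot A B = 0 by rewrite !dot_row_mx; lra.
have DD : dot D D = dot C C by rewrite !dot_row_mx; lra.
have CD : dot C D = 0 by rewrite !dot_row_mx; lra.
have BD : dot B D = dot A C by rewrite !dot_row_mx; lra.
have BC : dot B C = - dot A D by rewrite !dot_row_mx; lra.
clearbody A B C D.
rewrite -(@pmulr_rge0 _ ((k * m) ^+ 2)) ?exprn_gt0 ?mulr_gt0 //.
rewrite -(plane_form_shear _ _ _ _ _ _ l1 l2 cH).
set A' := k *: A; set B' := k *: B; set C' := m *: _; set D' := m *: _.
(* The change of basis keeps the plane isotropic. *)
case=> n1 n2 h1 h2.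
have BB' : dot B' B' = dot A' A' by rewrite /B' /A' !dotE BB.
have AB' : dot A' B' = 0 by rewrite /B' /A' !dotE AB !mulr0.
have DD' : dot D' D' = dot C' C'.
  by rewrite /D' /C' !dotE (dotC C A) (dotC C B) (dotC D A) (dotC D B) (dotC B A)
     BB AB DD BD BC; ring.
have CD' : dot C' D' = 0.
  by rewrite /D' /C' !dotE (dotC C A) (dotC C B) (dotC B A) BB AB CD BD BC; ring.
have BD' : dot B' D' = dot A' C'.
  by rewrite /A' /B' /D' /C' !dotE (dotC B A) BB AB BD; ring.
have BC' : dot B' C' = - dot A' D'.
  by rewrite /A' /B' /D' /C' !dotE (dotC B A) BB AB BC; ring.
clearbody A' B' C' D'.
have AC0 : dot A' C' = 0 by lra.
have AD0 : dot A' D' = 0 by lra.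
pose s : R := Num.sqrt 2.
have ss : s * s = 2 by rewrite -expr2 sqr_sqrtr.
have := isoS (s *: A') (s *: B') (s *: C') (s *: D').
have -> : hat S (s *: A') (s *: C') (s *: A') (s *: C')
    + hat S (s *: A') (s *: D') (s *: A') (s *: D')
    + hat S (s *: B') (s *: C') (s *: B') (s *: C')
    + hat S (s *: B') (s *: D') (s *: B') (s *: D')
    - 2 * hat S (s *: A') (s *: B') (s *: C') (s *: D') =
   (s * s) ^+ 2 * plane_form (hat S) A' B' C' D'.
  rewrite -(plane_form_shear _ _ _ _ _ _ 0 0 cH) !scale0r !addr0 subr0.
  by rewrite plane_form_isotropic.
rewrite ss pmulr_rge0; last by rewrite exprn_gt0.
apply; apply: orthonormal4; rewrite !dotE !mulrA ss; lra.
Qed.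

End Chat.

(** * The curvature tensor of the unit sphere *)

Definition form_add (R : realType) (n : nat) (S : form4 R n) (k : R) (T : form4 R n) : form4 R n :=
  fun u v w z => S u v w z + k * T u v w z.

Definition sphere_curvature (R : realType) (n : nat) : form4 R n :=
  fun u v w z => dot u w * dot v z - dot u z * dot v w.

Section Sphere.
Context (R : realType) (n : nat).
Implicit Types (S T : form4 R n).

Lemma form_add_curvature S k T : algebraic_curvature S -> algebraic_curvature T ->
  algebraic_curvature (form_add S k T).
Proof.
move=> cS cT; rewrite /form_add; split; first split.
- move=> v w z a x y; rewrite (curv_scalar1 cS) (curv_scalar1 cT) /=; ring.
- move=> u w z a x y; rewrite (curv_scalar2 cS) (curv_scalar2 cT) /=; ring.
- move=> u v z a x y; rewrite (curv_scalar3 cS) (curv_scalar3 cT) /=; ring.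
- move=> u v w a x y; rewrite (curv_scalar4 cS) (curv_scalar4 cT) /=; ring.
- move=> u v w z; rewrite (curv_skew12 cS) (curv_skew12 cT); ring.
- move=> u v w z; rewrite (curv_skew34 cS) (curv_skew34 cT); ring.
- by move=> u v w z; rewrite (curv_pair cS) (curv_pair cT).
- move=> u v w z; have := curv_bianchi cS u v w z.
  by have /(congr1 ( *%R k)) := curv_bianchi cT u v w z; lra.
Qed.

Lemma plane_form_add S k T a b c d :
  plane_form (form_add S k T) a b c d = plane_form S a b c d + k * plane_form T a b c d.
Proof. by rewrite /plane_form /form_add; ring. Qed.

Lemma sphere_curvature_algebraic : algebraic_curvature (@sphere_curvature R n).
Proof.
rewrite /sphere_curvature; split; first split.
- by move=> v w z a x y; rewrite !dotE; ring.
- by move=> v w z a x y; rewrite !dotE; ring.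
- by move=> v w z a x y; rewrite !dotE; ring.
- by move=> v w z a x y; rewrite !dotE; ring.
- by move=> u v w z; ring.
- by move=> u v w z; ring.
- by move=> u v w z; rewrite (dotC w) (dotC z v) (dotC w v) (dotC z u); ring.
- by move=> u v w z; rewrite (dotC w u) (dotC v u) (dotC w v); ring.
Qed.

Lemma plane_form_sphere a b c d : hermitian_orthonormal a b c d ->
  plane_form (@sphere_curvature R n) a b c d = 1.
Proof.
move=> [h1 h2 h3 h4]; rewrite /plane_form /sphere_curvature.
rewrite (dotC c a) (dotC d a) (dotC c b) (dotC d b) (dotC d c).
have -> : dot a c = - dot b d by lra.
have -> : dot a d = dot b c by lra.
have -> : dot b b = 1 - dot a a by lra.
have -> : dot d d = 1 - dot c c by lra.
ring.
Qed.

Lemma plane_form_frames S : algebraic_curvature S ->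
  (forall a b c d, hermitian_orthonormal a b c d -> 0 <= plane_form S a b c d) ->
  forall a b c d, 0 <= plane_form S a b c d.
Proof.
move=> cS pS a b c d.
have [->//|[k [m [l1 [l2 [k0 m0 /pS]]]]]] := hermitian_reduction a b c d.
by rewrite plane_form_shear // pmulr_rge0 // exprn_gt0 // mulr_gt0.
Qed.

End Sphere.

(** * Lipschitz bound for the quadratic map on unitary pairs *)

Section Bounds.
Context (R : realType) (n : nat).
Implicit Types (S T : form4 R n) (u v w z : 'rV[R]_n).

(** Components of unit vectors lie in [-1, 1], so a multilinear form is bounded
    on them by the sum of the absolute values of its components. *)
Definition in_cube u := forall i, `|u 0 i| <= 1.

Lemma basis_vector_cube i : in_cube (basis_vector R i).
Proof. by move=> j; rewrite mxE; case: (_ && _); rewrite ?normr1 ?normr0. Qed.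

Lemma dot_cube u : dot u u <= 1 -> in_cube u.
Proof.
move=> u1 i; rewrite -(@expr_le1 _ 2) // real_normK ?num_real //.
apply: le_trans u1; rewrite /dot (bigD1 i) //= -expr2 lerDl.
by apply: sumr_ge0 => j _; rewrite -expr2 sqr_ge0.
Qed.

Lemma hermitian_orthonormal_cube a b c d : hermitian_orthonormal a b c d ->
  [/\ in_cube a, in_cube b, in_cube c & in_cube d].
Proof.
move=> [ab cd _ _].
have := dot_ge0 a; have := dot_ge0 b; have := dot_ge0 c; have := dot_ge0 d.
by move=> ? ? ? ?; split; apply: dot_cube; lra.
Qed.

Definition component_norm S : R :=
  \sum_(i < n) \sum_(j < n) \sum_(k < n) \sum_(l < n)
    `|S (basis_vector R i) (basis_vector R j) (basis_vector R k) (basis_vector R l)|.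

Lemma scalar_cube_le (f : 'rV[R]_n -> R) u : scalar f -> in_cube u ->
  `|f u| <= \sum_i `|f (basis_vector R i)|.
Proof.
move=> fl cu; rewrite (scalar_coord u fl); apply: le_trans (ler_norm_sum _ _ _) _.
by apply: ler_sum => i _; rewrite normrM ler_piMl.
Qed.

Lemma component_norm_bound S u v w z : algebraic_curvature S ->
  in_cube u -> in_cube v -> in_cube w -> in_cube z ->
  `|S u v w z| <= component_norm S.
Proof.
move=> cS cu cv cw cz.
apply: le_trans (scalar_cube_le (curv_scalar1 cS v w z) cu) _; apply: ler_sum => i _.
apply: le_trans (scalar_cube_le (curv_scalar2 cS _ w z) cv) _; apply: ler_sum => j _.
apply: le_trans (scalar_cube_le (curv_scalar3 cS _ _ z) cw) _; apply: ler_sum => k _.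
exact: (scalar_cube_le (curv_scalar4 cS _ _ _) cz).
Qed.

Lemma component_norm_ge0 S : 0 <= component_norm S.
Proof. by do 4![apply: sumr_ge0 => ? _]. Qed.

Lemma plane_form_bound (F : form4 R n) (N : R) a b c d :
  in_cube a -> in_cube b -> in_cube c -> in_cube d ->
  (forall u v w z, in_cube u -> in_cube v -> in_cube w -> in_cube z -> `|F u v w z| <= N) ->
  `|plane_form F a b c d| <= 8 * N.
Proof.
move=> ca cb cc cd bF; rewrite /plane_form.
have := bF a c a c ca cc ca cc; have := bF b d b d cb cd cb cd.
have := bF a d a d ca cd ca cd; have := bF b c b c cb cc cb cc.
have := bF a d b c ca cd cb cc; have := bF a c b d ca cc cb cd.
rewrite !ler_norml => /andP[? ?] /andP[? ?] /andP[? ?] /andP[? ?] /andP[? ?] /andP[? ?].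
by apply/andP; split; lra.
Qed.

Lemma product_perturbation (N k x y s t : R) : 0 <= k <= 1 ->
  `|x| <= N -> `|y| <= N -> `|s| <= N -> `|t| <= N ->
  `|(x + k * s) * (y + k * t) - x * y| <= 3 * k * N ^+ 2.
Proof.
move=> /andP[k0 k1] hx hy hs ht.
have N0 : 0 <= N by apply: le_trans hx.
have -> : (x + k * s) * (y + k * t) - x * y = k * (x * t + s * y + k * (s * t)) by ring.
rewrite normrM (ger0_norm k0).
have pr p q : `|p| <= N -> `|q| <= N -> `|p * q| <= N ^+ 2.
  by move=> hp hq; rewrite normrM expr2 ler_pM.
have : `|x * t + s * y + k * (s * t)| <= 3 * N ^+ 2.
  have -> : 3 * N ^+ 2 = N ^+ 2 + N ^+ 2 + N ^+ 2 by ring.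
  apply: le_trans (ler_normD _ _) _; apply: lerD.
    by apply: le_trans (ler_normD _ _) _; apply: lerD; exact: pr.
  rewrite normrM (ger0_norm k0); apply: le_trans (pr _ _ hs ht).
  by rewrite ler_piMl.
have -> : 3 * k * N ^+ 2 = k * (3 * N ^+ 2) by ring.
exact: ler_wpM2l.
Qed.

(** Each of the n^2 summands of Q is a combination of three products with
    coefficients 1, 2, -2, each changing by at most 3 k N^2. *)
Lemma Q_perturbation S T k N u v w z : 0 <= k <= 1 ->
  (forall u v w z, in_cube u -> in_cube v -> in_cube w -> in_cube z -> `|S u v w z| <= N) ->
  (forall u v w z, in_cube u -> in_cube v -> in_cube w -> in_cube z -> `|T u v w z| <= N) ->
  in_cube u -> in_cube v -> in_cube w -> in_cube z ->
  `|Q (form_add S k T) u v w z - Q S u v w z| <= n%:R ^+ 2 * (15 * k * N ^+ 2).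
Proof.
move=> k01 bS bT cu cv cw cz; rewrite /Q -sumrB.
have dsum (f : 'I_n -> R) (M : R) : (forall i, `|f i| <= M) -> `|\sum_i f i| <= n%:R * M.
  move=> hf; apply: le_trans (ler_norm_sum _ _ _) _.
  by apply: le_trans (ler_sum _ (fun i _ => hf i)) _; rewrite sumr_const card_ord mulr_natl.
rewrite expr2 -mulrA; apply: (dsum) => p; rewrite -sumrB; apply: (dsum) => q.
have cp := basis_vector_cube p; have cq := basis_vector_cube q.
set e := basis_vector R p in cp *; set e' := basis_vector R q in cq *.
rewrite /= /form_add.
have H x1 x2 x3 x4 y1 y2 y3 y4 : in_cube x1 -> in_cube x2 -> in_cube x3 -> in_cube x4 ->
    in_cube y1 -> in_cube y2 -> in_cube y3 -> in_cube y4 ->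
    `|(S x1 x2 x3 x4 + k * T x1 x2 x3 x4) * (S y1 y2 y3 y4 + k * T y1 y2 y3 y4)
      - S x1 x2 x3 x4 * S y1 y2 y3 y4| <= 3 * k * N ^+ 2.
  by move=> *; apply: product_perturbation; rewrite // ?bS ?bT.
have := H _ _ _ _ _ _ _ _ cu cv cp cq cw cz cp cq.
have := H _ _ _ _ _ _ _ _ cu cp cw cq cv cp cz cq.
have := H _ _ _ _ _ _ _ _ cu cp cz cq cv cp cw cq.
rewrite !ler_norml => /andP[? ?] /andP[? ?] /andP[? ?].
by apply/andP; split; lra.
Qed.

End Bounds.

(** * Compactness of the set of unitary pairs *)

Section Compactness.
Context (R : realType) (n : nat).

Lemma continuous_sum_ord (T : topologicalType) m (f : 'I_m -> T -> R) :
  (forall i, continuous (f i)) -> continuous (fun x => \sum_i f i x).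
Proof.
move=> cf.
by apply: continuous_big => //; exact: add_continuous.
Qed.

Lemma continuous_mul (T : topologicalType) (f g : T -> R) :
  continuous f -> continuous g -> continuous (fun x => f x * g x).
Proof. by move=> cf cg x; apply: cvgM; [exact: cf|exact: cg]. Qed.

Lemma continuous_add (T : topologicalType) (f g : T -> R) :
  continuous f -> continuous g -> continuous (fun x => f x + g x).
Proof. by move=> cf cg x; apply: cvgD; [exact: cf|exact: cg]. Qed.

Lemma continuous_sub (T : topologicalType) (f g : T -> R) :
  continuous f -> continuous g -> continuous (fun x => f x - g x).
Proof. by move=> cf cg x; apply: cvgB; [exact: cf|exact: cg]. Qed.

Lemma continuous_dot (T : topologicalType) (f g : T -> 'rV[R]_n) :
  (forall i, continuous (fun x => f x 0 i)) -> (forall i, continuous (fun x => g x 0 i)) ->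
  continuous (fun x => dot (f x) (g x)).
Proof.
by move=> cf cg; apply: continuous_sum_ord => i; exact: continuous_mul.
Qed.

Lemma curv_coord (S : form4 R n) u v w z : algebraic_curvature S ->
  S u v w z = \sum_i \sum_j \sum_k \sum_l u 0 i * (v 0 j * (w 0 k * (z 0 l *
    S (basis_vector R i) (basis_vector R j) (basis_vector R k) (basis_vector R l)))).
Proof.
move=> cS.
rewrite (scalar_coord u (curv_scalar1 cS v w z)); apply: eq_bigr => i _.
rewrite (scalar_coord v (curv_scalar2 cS _ w z)) mulr_sumr; apply: eq_bigr => j _.
rewrite (scalar_coord w (curv_scalar3 cS _ _ z)) !mulr_sumr; apply: eq_bigr => k _.
rewrite (scalar_coord z (curv_scalar4 cS _ _ _)) !mulr_sumr; apply: eq_bigr => l _.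
by [].
Qed.

Lemma continuous_curv (T : topologicalType) (S : form4 R n) (f g h k : T -> 'rV[R]_n) :
  algebraic_curvature S ->
  (forall i, continuous (fun x => f x 0 i)) -> (forall i, continuous (fun x => g x 0 i)) ->
  (forall i, continuous (fun x => h x 0 i)) -> (forall i, continuous (fun x => k x 0 i)) ->
  continuous (fun x => S (f x) (g x) (h x) (k x)).
Proof.
move=> cS cf cg ch ck.
rewrite (_ : (fun x => _) = fun x => \sum_i \sum_j \sum_p \sum_l
    f x 0 i * (g x 0 j * (h x 0 p * (k x 0 l *
    S (basis_vector R i) (basis_vector R j) (basis_vector R p) (basis_vector R l))))); last first.
  by apply/funext => x; exact: curv_coord.
do 4![apply: continuous_sum_ord => ?].
do 4![apply: continuous_mul => //].
by move=> x; exact: cvg_cst.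
Qed.

Lemma frames_min (S : form4 R n) : algebraic_curvature S ->
  (forall a b c d, hermitian_orthonormal a b c d -> 0 < plane_form S a b c d) ->
  exists2 m, 0 < m &
    forall a b c d, hermitian_orthonormal a b c d -> m <= plane_form S a b c d.
Proof.
move=> cS pS.
pose V := 'rV[R]_((n + n) + (n + n)).
pose fa (x : V) := lsubmx (lsubmx x); pose fb (x : V) := rsubmx (lsubmx x).
pose fc (x : V) := lsubmx (rsubmx x); pose fd (x : V) := rsubmx (rsubmx x).
have ca i : continuous (fun x => fa x 0 i).
  by under [X in continuous X]eq_fun do rewrite !mxE; exact: coord_continuous.
have cb i : continuous (fun x => fb x 0 i).
  by under [X in continuous X]eq_fun do rewrite !mxE; exact: coord_continuous.
have cc i : continuous (fun x => fc x 0 i).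
  by under [X in continuous X]eq_fun do rewrite !mxE; exact: coord_continuous.
have cd i : continuous (fun x => fd x 0 i).
  by under [X in continuous X]eq_fun do rewrite !mxE; exact: coord_continuous.
pose K := [set x : V | hermitian_orthonormal (fa x) (fb x) (fc x) (fd x)].
pose f x := plane_form S (fa x) (fb x) (fc x) (fd x).
have [[x0 Kx0]|K0] := pselect (K !=set0); last first.
  (* In dimension at most one there are no unitary pairs. *)
  exists 1 => // a b c d h; exfalso; apply: K0.
  exists (row_mx (row_mx a b) (row_mx c d)).
  by rewrite /K /= /fa /fb /fc /fd !(row_mxKl, row_mxKr).
have KC : compact K.
  have cube : compact [set v : V | forall i, `[(-1 : R), 1]%classic (v ord0 i)].
    apply: (@rV_compact _ _ (fun=> `[(-1 : R), 1]%classic)) => _; exact: segment_compact.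
  apply: subclosed_compact cube _.
    have -> : K = [set x | dot (fa x) (fa x) + dot (fb x) (fb x) = 1] `&`
        [set x | dot (fc x) (fc x) + dot (fd x) (fd x) = 1] `&`
        [set x | dot (fa x) (fc x) + dot (fb x) (fd x) = 0] `&`
        [set x | dot (fa x) (fd x) - dot (fb x) (fc x) = 0].
      apply/seteqP; split => x /=; last by case=> [[[? ?] ?] ?]; split.
      by case=> h1 h2 h3 h4; exact: (conj (conj (conj h1 h2) h3) h4).
    have cl (h : V -> R) y : continuous h -> closed [set x | h x = y].
      move=> ch; apply: (@preimage_closed _ _ h [set y]) => [x _|]; first exact: ch.
      exact: closed_eq.
    do 3?[apply: closedI]; apply: cl;
      first [apply: continuous_sub|apply: continuous_add]; exact: continuous_dot.
  move=> v /hermitian_orthonormal_cube [ha hb hc hd] i /=.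
  rewrite in_itv /= -ler_norml -(hsubmxK v) mxE; case: (fintype.split i) => j.
    rewrite -(hsubmxK (lsubmx v)) mxE; case: (fintype.split j) => k; [exact: ha|exact: hb].
  rewrite -(hsubmxK (rsubmx v)) mxE; case: (fintype.split j) => k; [exact: hc|exact: hd].
have cf : {within K, continuous f}.
  apply: continuous_subspaceT; rewrite /f /plane_form.
  apply: continuous_add.
    by do 3![apply: continuous_add; last exact: continuous_curv]; exact: continuous_curv.
  apply: (@continuous_mul _ (fun=> 2)); first exact: cst_continuous.
  by apply: continuous_sub; exact: continuous_curv.
have [x Kx xmin] := EVT_min_rV (ex_intro _ x0 Kx0) KC cf.
rewrite inE in Kx.
exists (f x); first exact: pS.
move=> a b c d h.
have := xmin (row_mx (row_mx a b) (row_mx c d)).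
rewrite inE /K /f /= /fa /fb /fc /fd !(row_mxKl, row_mxKr); exact.
Qed.

End Compactness.

(** * Induction along a real interval *)

Section RealInduction.
Context (R : realType).

(** The supremum of the times up to which P holds belongs to them by the second
    closure property, and cannot be less than T by the first. *)
Lemma real_induction (T : R) (P : R -> Prop) : 0 <= T -> P 0 ->
  (forall t, 0 <= t < T -> (forall s, 0 <= s <= t -> P s) -> exists2 d, 0 < d &
     forall s, t < s < t + d -> s <= T -> P s) ->
  (forall t, 0 < t <= T -> (forall s, 0 <= s < t -> P s) -> P t) ->
  P T.
Proof.
move=> T0 P0 ext clo.
pose A := [set t | 0 <= t <= T /\ forall s, 0 <= s <= t -> P s].
have A0 : A 0.
  split; first by rewrite lexx.
  by move=> s s0; rewrite (_ : s = 0) //; apply/eqP; rewrite eq_sym eq_le.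
have ubA : has_ubound A by exists T => t [/andP[]].
have supA : has_sup A by split=> //; exists 0.
set m := sup A.
have m0 : 0 <= m by apply: ub_le_sup.
have mT : m <= T by apply: ge_sup; [exists 0|move=> t [/andP[]]].
have below s : 0 <= s < m -> P s.
  move=> /andP[s0 sm]; have e0 : 0 < m - s by rewrite subr_gt0.
  have [t [_ Pt] st] := sup_adherent e0 supA.
  by apply: Pt; rewrite s0 ltW //; move: st; rewrite -/m; lra.
have Pm : P m.
  have [->//|mn] := eqVneq m 0.
  by apply: clo => //; rewrite mT lt_neqAle eq_sym mn m0.
have [mT'|] := ltP m T; last by move=> Tm; rewrite (_ : T = m) //; apply/eqP; rewrite eq_le mT Tm.
have [d d0 Pd] : exists2 d, 0 < d & forall s, m < s < m + d -> s <= T -> P s.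
  apply: ext => [|s /andP[s0]]; first by rewrite m0.
  by rewrite le_eqVlt => /orP[/eqP ->//|sm]; apply: below; rewrite s0.
pose s := Num.min (m + d / 2) T.
have ms : m < s by rewrite lt_min mT' andbT; lra.
have sT : s <= T by rewrite ge_min lexx orbT.
have sd : s <= m + d / 2 by rewrite ge_min lexx.
suff /(ub_le_sup ubA) : A s by rewrite leNgt -/m ms.
split; first by rewrite sT andbT; lra.
move=> r /andP[r0 rs]; have [rm|mr|->//] := ltgtP r m; first by apply: below; rewrite r0.
by apply: Pd; [apply/andP; split; lra|lra].
Qed.

End RealInduction.

(** * Derivatives relative to a set *)

Section DeriveWithin.
Context (R : realType) (D : set R).

Lemma is_derive_within_ball (f : R -> R) t l e : is_derive_within D f t l -> 0 < e ->
  exists2 d, 0 < d & forall s, D s -> s != t -> `|s - t| < d ->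
    `|(f s - f t) / (s - t) - l| < e.
Proof.
move=> /cvgrPdist_lt h e0; have := h _ e0.
rewrite near_withinE near_withinE => /nbhs_ballP [d /= d0 hd].
exists d => // s Ds st sd; rewrite distrC; apply: hd => //.
by rewrite -ball_normE /= distrC.
Qed.

Lemma is_derive_withinD (f g : R -> R) t l k :
  is_derive_within D f t l -> is_derive_within D g t k ->
  is_derive_within D (fun s => f s + g s) t (l + k).
Proof.
move=> hf hg; rewrite /is_derive_within.
rewrite (_ : (fun s => _) = (fun s => (f s - f t) / (s - t) + (g s - g t) / (s - t))).
  exact: cvgD.
by apply/funext => s; rewrite -mulrDl; congr (_ / _); ring.
Qed.

Lemma is_derive_withinZ (f : R -> R) t l (c : R) :
  is_derive_within D f t l -> is_derive_within D (fun s => c * f s) t (c * l).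
Proof.
move=> hf; rewrite /is_derive_within.
rewrite (_ : (fun s => _) = (fun s => c * ((f s - f t) / (s - t)))).
  by apply: cvgM => //; exact: cvg_cst.
by apply/funext => s; rewrite mulrA mulrBr.
Qed.

Lemma is_derive_within_cvg (f : R -> R) t l : is_derive_within D f t l ->
  f s @[s --> within D (nbhs t)] --> f t.
Proof.
move=> df; apply/cvgrPdist_lt => e e0.
have [d d0 hd] := is_derive_within_ball df ltr01.
rewrite near_withinE; apply/nbhs_ballP.
have l0 : 0 < `|l| + 1 by rewrite ltr_wpDl.
exists (Num.min d (e / (`|l| + 1))) => /=; first by rewrite lt_min d0 divr_gt0.
move=> s; rewrite -ball_normE /= lt_min => /andP[sd se] Ds.
have [->|st] := eqVneq s t; first by rewrite subrr normr0.
rewrite distrC; rewrite distrC in sd; rewrite distrC in se.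
have n0 : s - t != 0 by rewrite subr_eq0.
have := hd s Ds st sd; set q := (f s - f t) / (s - t) => hq.
have -> : f s - f t = q * (s - t) by rewrite /q mulfVK.
have ql : `|q| <= `|l| + 1.
  rewrite -(subrK l q) addrC; apply: le_trans (ler_normD _ _) _; rewrite lerD2l ltW //.
rewrite normrM; apply: le_lt_trans (_ : (`|l| + 1) * `|s - t| < _).
  by rewrite ler_wpM2r.
by rewrite mulrC -ltr_pdivlMr.
Qed.

(** If f + c exp (L (s - t)) is nonnegative before t and not positive at t, its
    left derivative at t is at most 0, so f has slope at most - c L there.  The
    weaker constant c L / 2 needs only the bound 1 + y <= exp y, and no derivative
    of the exponential. *)
Lemma barrier_slope (f : R -> R) t l c L : 0 < t -> (forall s, 0 <= s <= t -> D s) ->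
  is_derive_within D f t l -> 0 < c -> 0 < L -> f t + c <= 0 ->
  (forall s, 0 <= s < t -> 0 <= f s + c * expR (L * (s - t))) ->
  l <= - (c * L / 2).
Proof.
move=> t0 Dt df c0 L0 ft fs; rewrite leNgt; apply/negP => hl.
have e0 : 0 < l + c * L / 2 by lra.
have [d d0 hd] := is_derive_within_ball df e0.
(* A step back from t that stays in the domain and within distance d, with
   L h <= 1. *)
pose h := Num.min (Num.min (d / 2) t) L^-1.
have h0 : 0 < h by rewrite !lt_min t0 invr_gt0 L0 !andbT; lra.
have hd2 : h <= d / 2 by rewrite !ge_min lexx.
have ht : h <= t by rewrite !ge_min lexx orbT.
have hL : L * h <= 1.
  by rewrite mulrC -ler_pdivlMr // mul1r !ge_min lexx orbT.
have Ds : D (t - h) by apply: Dt; apply/andP; split; lra.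
have nt : t - h != t by rewrite lt_eqF //; lra.
have dist : `|t - h - t| < d by rewrite (_ : t - h - t = - h) ?normrN ?gtr0_norm; lra.
have := hd _ Ds nt dist; rewrite ltr_norml => /andP[+ _].
have := fs (t - h); rewrite (_ : t - h - t = - h); last by ring.
have rng : 0 <= t - h < t by apply/andP; split; lra.
rewrite mulrN expRN => /(_ rng).
set y := L * h in hL *; have y0 : 0 < y by rewrite mulr_gt0.
have Ey : 1 + y <= expR y by apply: expR_ge1Dx.
have E0 : 0 < (expR y)^-1 by rewrite invr_gt0 expR_gt0.
have E1 : (expR y)^-1 * (1 + y) <= 1.
  by rewrite mulrC ler_pdivrMr ?expR_gt0 // mul1r.
set E := (expR y)^-1 in E0 E1 *.
(* E <= 1 / (1 + y) and y <= 1. *)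
have E2 : y / 2 <= 1 - E by nra.
move=> H1; rewrite invrN mulrN -mulNr => H2.
have : - (f (t - h) - f t) / h <= - (c * L / 2).
  rewrite ler_pdivrMr //.
  have : c * (y / 2) <= c * (1 - E) by rewrite ler_wpM2l // ltW.
  rewrite /y; lra.
lra.
Qed.

End DeriveWithin.

(** * Invariance under the ODE *)

Section OdeInvariance.
Context (R : realType) (n : nat) (tau : \bar R) (S : R -> form4 R n).
Hypothesis solS : ode_solution tau S.
Let D := time_interval tau.

Lemma solution_curvature t : D t -> algebraic_curvature (S t).
Proof. by move=> /solS []. Qed.

Lemma solution_plane_form t a b c d : D t ->
  is_derive_within D (fun s => plane_form (S s) a b c d) t
    (plane_form (Q (S t)) a b c d).
Proof.
move=> /solS [_ dS]; rewrite /plane_form.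
have dN u v w z : is_derive_within D (fun s => - S s u v w z) t (- Q (S t) u v w z).
  have := is_derive_withinZ (c := -1) (dS u v w z).
  by rewrite mulN1r; under [X in is_derive_within _ X]eq_fun do rewrite mulN1r.
apply: is_derive_withinD; first by do 3![apply: is_derive_withinD => //].
by apply: is_derive_withinZ; exact: is_derive_withinD.
Qed.

Lemma solution_cvg t u v w z : D t ->
  S s u v w z @[s --> within D (nbhs t)] --> S t u v w z.
Proof. by move=> /solS [_ dS]; exact: is_derive_within_cvg (dS u v w z). Qed.

Lemma component_norm_cvg t (k : R) (T : form4 R n) : D t ->
  component_norm (form_add (S s) k T) @[s --> within D (nbhs t)] -->
  component_norm (form_add (S t) k T).
Proof.
move=> Dt; rewrite /component_norm /form_add.
do 4![apply: cvg_big => [|? _]; first exact: add_continuous].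
by apply: cvg_norm; apply: cvgD; [exact: solution_cvg|exact: cvg_cst].
Qed.

Lemma time_interval_sub T s : D T -> 0 <= s <= T -> D s.
Proof.
move=> [_ T1] /andP[s0 sT]; split=> //.
by apply: le_lt_trans T1; rewrite lee_fin.
Qed.

Lemma component_norm_bounded T : D T ->
  exists N : R, forall s, 0 <= s <= T -> component_norm (S s) <= N.
Proof.
move=> DT; have T0 : 0 <= T by case: DT.
have cf : {within `[0, T], continuous (fun s => component_norm (S s))}.
  apply/subspace_continuousP => t /= tT; rewrite in_itv /= in tT.
  have Dt := time_interval_sub DT tT.
  have h : component_norm (S s) @[s --> within D (nbhs t)] --> component_norm (S t).
    do 4![apply: cvg_big => [|? _]; first exact: add_continuous].
    by apply: cvg_norm; exact: solution_cvg.
  apply: cvg_trans h; apply: cvg_app; apply: within_subset => s /= sT.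
  by apply: time_interval_sub DT _; rewrite in_itv /= in sT.
have [m _ hm] := EVT_max T0 cf.
by exists (component_norm (S m)) => s sT; apply: hm; rewrite in_itv.
Qed.

Lemma component_norm_close t e : D t -> 0 < e -> exists2 d, 0 < d &
  forall s, D s -> `|s - t| < d -> component_norm (form_add (S s) (-1) (S t)) < e.
Proof.
move=> Dt e0; have := component_norm_cvg (k := -1) (T := S t) Dt.
rewrite (_ : component_norm (form_add (S t) _ _) = 0); last first.
  by rewrite /component_norm; do 4![rewrite big1 // => ? _]; rewrite /form_add mulN1r subrr normr0.
move=> /cvgrPdist_lt /(_ _ e0); rewrite near_withinE => /nbhs_ballP [d /= d0 hd].
exists d => // s Ds sd; have := hd s; rewrite -ball_normE /= distrC => /(_ sd Ds).
by rewrite sub0r normrN ger0_norm // component_norm_ge0.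
Qed.

End OdeInvariance.

Lemma plane_form_Q_perturbation (R : realType) (n : nat) (S T : form4 R n) (k N : R) a b c d :
  algebraic_curvature S -> algebraic_curvature T -> 0 <= k <= 1 ->
  component_norm S <= N -> component_norm T <= N -> hermitian_orthonormal a b c d ->
  plane_form (Q (form_add S k T)) a b c d - plane_form (Q S) a b c d
    <= 120 * n%:R ^+ 2 * N ^+ 2 * k.
Proof.
move=> cS cT k01 SN TN /hermitian_orthonormal_cube [ca cb cc cd].
have -> : plane_form (Q (form_add S k T)) a b c d - plane_form (Q S) a b c d =
    plane_form (form_add (Q (form_add S k T)) (-1) (Q S)) a b c d.
  by rewrite plane_form_add mulN1r.
have -> : 120 * n%:R ^+ 2 * N ^+ 2 * k = 8 * (n%:R ^+ 2 * (15 * k * N ^+ 2)) by ring.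
apply: le_trans (ler_norm _) _; apply: plane_form_bound => // u v w z cu cv cw cz.
rewrite {1}/form_add mulN1r; apply: Q_perturbation => // u' v' w' z' cu' cv' cw' cz'.
  by apply: le_trans SN; exact: component_norm_bound.
by apply: le_trans TN; exact: component_norm_bound.
Qed.

Lemma plane_form_close (R : realType) (n : nat) (S T : form4 R n) a b c d :
  algebraic_curvature S -> algebraic_curvature T -> hermitian_orthonormal a b c d ->
  `|plane_form S a b c d - plane_form T a b c d| <= 8 * component_norm (form_add S (-1) T).
Proof.
move=> cS cT /hermitian_orthonormal_cube [ca cb cc cd].
have -> : plane_form S a b c d - plane_form T a b c d =
    plane_form (form_add S (-1) T) a b c d by rewrite plane_form_add mulN1r.
apply: plane_form_bound => // u v w z cu cv cw cz.
by apply: component_norm_bound => //; exact: form_add_curvature.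
Qed.

(** The barrier argument.  K is a Lipschitz constant for Q on unitary pairs in
    the region where the solution stays on [0, T], and g t the coefficient of the
    sphere curvature, with g T = e.  At a first contact the derivative of
    [plane_form (S t)] is at least - K g by [Q_plane_form_ge0] and at most
    - L g / 2 by [barrier_slope]; L = 2 K + 2 makes this impossible.  The
    nonnegativity of the sum is propagated by [real_induction]. *)
Lemma ode_nonneg_plane_form (R : realType) (n : nat) (tau : \bar R)
    (S : R -> form4 R n) (T : R) : ode_solution tau S -> time_interval tau T ->
  (forall a b c d, 0 <= plane_form (S 0) a b c d) ->
  forall a b c d, 0 <= plane_form (S T) a b c d.
Proof.
move=> sol DT p0.
have T0 : 0 <= T by case: DT.
set D := time_interval tau in DT *.
have DS t : 0 <= t <= T -> D t by exact: time_interval_sub DT.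
have cS t : 0 <= t <= T -> algebraic_curvature (S t).
  by move=> /DS; exact: solution_curvature sol _.
pose I := @sphere_curvature R n.
have cI : algebraic_curvature I := sphere_curvature_algebraic R n.
have I0 : forall a b c d, 0 <= plane_form I a b c d.
  by apply: plane_form_frames => // a b c d /plane_form_sphere ->.
have [N0 hN0] := component_norm_bounded sol DT.
pose N := Num.max N0 (component_norm I).
have IN : component_norm I <= N by rewrite le_max lexx orbT.
have SN t : 0 <= t <= T -> component_norm (S t) <= N.
  by move=> /hN0 h; rewrite le_max h.
pose K := 120 * n%:R ^+ 2 * N ^+ 2.
have K0 : 0 <= K by rewrite /K -mulrA -exprMn mulr_ge0 // sqr_ge0.
pose L := 2 * K + 2.
have L0 : 0 < L by rewrite /L; lra.
suff main (e : R) : 0 < e <= 1 ->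
    forall a b c d, 0 <= plane_form (form_add (S T) e I) a b c d.
  move=> a b c d; rewrite leNgt; apply/negP => neg.
  set p := plane_form (S T) a b c d in neg.
  set i := plane_form I a b c d.
  have i0 : 0 <= i by exact: I0.
  have i1 : 0 < i + 1 by rewrite ltr_wpDl.
  (* With this e the term e i is at most - p / 2, too small to compensate p. *)
  pose e := Num.min 1 (- p / (2 * (i + 1))).
  have e0 : 0 < e by rewrite lt_min ltr01 divr_gt0 ?oppr_gt0 // mulr_gt0.
  have ep : e * (2 * (i + 1)) <= - p by rewrite -ler_pdivlMr ?mulr_gt0 // ge_min lexx orbT.
  have := main e _ a b c d; rewrite plane_form_add -/p -/i.
  move=> /(_ _) h; have : 0 <= p + e * i by apply: h; rewrite e0 ge_min lexx.
  lra.
move=> /andP[e0 e1].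
pose g t := e * expR (L * (t - T)).
have g0 t : 0 < g t by rewrite mulr_gt0 ?expR_gt0.
have gmono s t : s <= t -> g s <= g t.
  move=> st; rewrite /g ler_pM2l // ler_expR ler_pM2l //; lra.
have gT : g T = e by rewrite /g subrr mulr0 expR0 mulr1.
have g1 t : t <= T -> g t <= 1 by move=> /gmono; rewrite gT => /le_trans; apply.
have gshift s t : g s = g t * expR (L * (s - t)).
  by rewrite /g -mulrA -expRD; congr (_ * expR _); ring.
rewrite -gT.
pose P t := forall a b c d, 0 <= plane_form (form_add (S t) (g t) I) a b c d.
apply: (@real_induction _ T P) => //.
- by move=> a b c d; rewrite plane_form_add addr_ge0 // mulr_ge0 // ltW.
(* Extension: the sum is strictly positive on unitary pairs at time t, hence
   bounded below by some m > 0, and S moves little while g increases. *)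
- move=> t /andP[t0 tT] Ps.
  have rt : 0 <= t <= T by rewrite t0 ltW.
  have Dt := DS t rt.
  have Pt : P t by apply: Ps; rewrite t0 lexx.
  have cS't := form_add_curvature (g t) (cS t rt) cI.
  have gt01 : 0 <= g t <= 1 by rewrite ltW //= g1 // ltW.
  have pos a b c d : hermitian_orthonormal a b c d ->
      0 < plane_form (form_add (S t) (g t) I) a b c d.
    move=> fr; rewrite lt_neqAle Pt andbT eq_sym; apply/eqP => z.
    have tang := Q_plane_form_ge0 cS't Pt z.
    have := plane_form_Q_perturbation (cS t rt) cI gt01 (SN t rt) IN fr.
    rewrite -/K => pert.
    rewrite plane_form_add plane_form_sphere // mulr1 in z.
    have [t00|tn] := eqVneq t 0.
      by have := p0 a b c d; have := g0 0; move: z; rewrite t00; lra.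
    have tp : 0 < t by rewrite lt_neqAle eq_sym tn.
    have Dsub s : 0 <= s <= t -> D s.
      by move=> /andP[s0 st]; apply: DS; apply/andP; split; lra.
    have slope : plane_form (Q (S t)) a b c d <= - (g t * L / 2).
      have df := solution_plane_form sol Dt (a := a) (b := b) (c := c) (d := d).
      apply: (@barrier_slope _ _ _ _ _ (g t) L tp Dsub df) => //.
        by rewrite z.
      move=> s /andP[s0 st]; rewrite -gshift.
      have Pst : P s by apply: Ps; rewrite s0 ltW.
      by have := Pst a b c d; rewrite plane_form_add plane_form_sphere // mulr1.
    have := g0 t; move: pert slope tang; rewrite /L.
    set q := plane_form (Q (S t)) a b c d; set q' := plane_form _ a b c d.
    have -> : g t * (2 * K + 2) / 2 = K * g t + g t by field.
    lra.
  have [m m0 hm] := frames_min cS't pos.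
  have [r r0 hr] := component_norm_close sol Dt (divr_gt0 m0 (ltr0n R 8)).
  exists r => // s /andP[ts sr] sT.
  have rs : 0 <= s <= T by apply/andP; split; lra.
  have cS's := form_add_curvature (g s) (cS s rs) cI.
  apply: plane_form_frames => // a b c d fr.
  have close := plane_form_close (cS s rs) (cS t rt) fr.
  have small : component_norm (form_add (S s) (-1) (S t)) < m / 8%:R.
    by apply: hr; [exact: DS|rewrite gtr0_norm; lra].
  have := hm a b c d fr; rewrite !plane_form_add plane_form_sphere // !mulr1.
  have := gmono t s (ltW ts); move: close; rewrite ler_norml => /andP[+ _].
  lra.
(* Closure: a negative value at t would persist shortly before t, where the
   coefficient g is even smaller. *)
- move=> t /andP[t0 tT] Pt a b c d; rewrite leNgt; apply/negP => neg.
  rewrite plane_form_add in neg.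
  set p := plane_form (S t) a b c d in neg.
  have Dt : D t by apply: DS; rewrite tT ltW.
  have := is_derive_within_cvg (solution_plane_form sol Dt (a := a) (b := b) (c := c) (d := d)).
  rewrite -/p => /cvgrPdist_lt.
  set y := p + _ in neg; have y0 : 0 < - y by rewrite oppr_gt0.
  move=> /(_ _ y0); rewrite near_withinE => /nbhs_ballP [r /= r0 hr].
  pose h := Num.min (r / 2) t.
  have h0 : 0 < h by rewrite lt_min t0 andbT; lra.
  have hr2 : h <= r / 2 by rewrite ge_min lexx.
  have ht : h <= t by rewrite ge_min lexx orbT.
  have Ds : D (t - h) by apply: DS; apply/andP; split; lra.
  have := hr (t - h); rewrite -ball_normE /= opprB addrC subrK gtr0_norm //.
  have hr' : h < r by lra.
  move=> /(_ hr' Ds); rewrite ltr_norml => /andP[h1 _].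
  have rng : 0 <= t - h < t by apply/andP; split; lra.
  have := Pt _ rng a b c d; rewrite plane_form_add.
  have gg : g (t - h) <= g t by apply: gmono; lra.
  have : g (t - h) * plane_form I a b c d <= g t * plane_form I a b c d.
    by rewrite ler_wpM2r.
  move: h1; rewrite /y; lra.
Qed.

Theorem proposition12 (R : realType) (n : nat) (hn : (4 <= n)%N) :
  ode_invariant (@Chat R n) /\
  (forall S : form4 R n, Chat S -> nonneg_sectional S) /\
  (forall S : form4 R n,
     algebraic_curvature S -> nonneg_curvature_operator S -> Chat S).
Proof.
split; last split.
- move=> tau S _ sol [cS0 isoS0] t Dt.
  have cSt := solution_curvature sol Dt.
  split=> //; apply: nonneg_isotropic_hat => //.
  apply: (ode_nonneg_plane_form sol Dt) => a b c d.
  exact: isotropic_hat_plane_form.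
- move=> S [cS isoS] u v _.
  have := isotropic_hat_plane_form cS u 0 v 0 isoS.
  rewrite plane_form_isotropic //.
  rewrite !(lin_form0 (curv_scalar2 cS _ _ _)) (lin_form0 (curv_scalar1 cS _ _ _)).
  by rewrite mulr0 !addr0 subr0.
- move=> S cS pS; split=> //; apply: nonneg_isotropic_hat => // a b c d.
  exact: nonneg_curvature_plane_form.
Qed.
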